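(* All twenty-four quasiparabolic Gelfand models of type $B_3$ have termwise Hecke deformations of their natural lattices, with compatible bar operators and explicit canonical bases. Among the sixteen additional models $\mathscr N_1,\dots,\mathscr N_8,\omega\mathscr N_1,\dots,\omega\mathscr N_8$, precisely \[ \mathscr N_3,\ \mathscr N_4,\ \mathscr N_5,\qquad \omega\mathscr N_3,\ \omega\mathscr N_4,\ \omega\mathscr N_5 \] admit termwise natural integral canonical $W$-graphs. Each of the other ten contains a natural summand lattice which cannot be the specialization of any integral $W$-graph module. Including the eight perfect models, the total number of type $B_3$ models admitting termwise natural canonical $W$-graphs is fourteen.
   Context: Group and characters. $W=B_3=N_3\rtimes S_3$ is the signed permutation group, $N_3=\langle f_1,f_2,f_3\rangle$ with $f_i$ changing the sign of coordinate $i$; simple generators $s_0=f_1$, $s_1=(12)$, $s_2=(23)$; $p:W\to S_3$ the projection; $\varepsilon(w)=(-1)^{\#\{i\in\{1,2,3\}:w(i)<0\}}$, $\delta(w)=\mathrm{sgn}(p(w))$, $\omega=\varepsilon\delta$. $R$ is the reflection character, $U$ the inflation of the degree-two character of $S_3$. Put $P=\langle s_1,s_2\rangle$, $K=P\times\langle -I\rangle$, $W^+=\ker\omega$. For $\tau\in\{\mathbf 1,\delta,\varepsilon,\omega\}$: $A_\tau=\tau(\mathbf 1+U)$, $B_\tau=\tau(\mathbf 1+U+R)$, $E_\tau=\tau(\mathbf 1+U+R+\varepsilon R+\delta R)$, $F_\tau=\tau(\mathbf 1+\varepsilon R)$, induced from the restriction of $\tau$ to $N_3\rtimes\langle(12)\rangle$,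 $\langle s_0,s_1\rangle$, $\langle s_0,s_2\rangle$, $K$ respectively; $C=\mathrm{Ind}_P^W\mathbf 1$, $D=\mathrm{Ind}_{\langle(12),f_1f_2\rangle}^W\mathbf 1$, $L_+=\mathrm{Ind}_{W^+}^W\mathbf 1=\mathbf 1+\omega$, $L_-=\mathrm{Ind}_{W^+}^W(\delta|_{W^+})=\delta+\varepsilon$; the four linear characters are induced from $W$ itself. The twenty-four models (up to equality of individual characters) are: the eight perfect models, namely $\{C,\delta D\}$, $\{C,B_\delta,B_\omega\}$, $\{B_\varepsilon,E_\delta,\mathbf 1,\omega\}$, $\{E_\omega,B_{\mathbf 1},\delta,\varepsilon\}$ and their $\omega$-twists; and the sixteen additional ones, namely $\mathscr N_1=\{F_{\mathbf 1},F_\varepsilon,B_\delta,B_\omega\}$, $\mathscr N_2=\{F_{\mathbf 1},F_\varepsilon,\delta D\}$, $\mathscr N_3=\{F_{\mathbf 1},E_\delta,A_\varepsilon,\omega\}$, $\mathscr N_4=\{F_{\mathbf 1},E_\delta,A_\omega,\varepsilon\}$, $\mathscr N_5=\{B_\varepsilon,E_\delta,L_+\}$, $\mathscr N_6=\{E_\omega,F_\varepsilon,A_{\mathbf 1},\delta\}$, $\mathscr N_7=\{E_\omega,F_\varepsilon,A_\delta,\mathbf 1\}$, $\mathscr N_8=\{E_\omega,B_{\mathbf 1},L_-\}$ and their $\omega$-twists $\omega\mathscr N_i$ (multiply each member by $\omega$). The natural lattice of a term $\mathrm{Ind}_H^W(\sigma|_H)$ is $L(H,\sigma)=\mathbb ZW\otimes_{\mathbb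 ZH}\mathbb Z_{\sigma|_H}$, where $H$ acts on the rank-one factor by $\sigma|_H$; here the inducing data are the subgroups and linear characters listed in the definitions of $A_\tau,B_\tau,E_\tau,F_\tau,C,D,L_+,L_-$ and of the four linear characters (with a twist by a linear character $\tau'$ of $W$ replacing $\sigma|_H$ by $(\tau'\sigma)|_H$). Hecke notions. $\mathcal A=\mathbb Z[v,v^{-1}]$, $a=v-v^{-1}$; $\mathcal H(W)$ is the $\mathcal A$-algebra generated by $T_s$ ($s\in S$) with the braid relations and $T_s^2=1+aT_s$; bar involution: ring involution with $\overline v=v^{-1}$, $\overline{T_s}=T_s^{-1}=T_s-a$. A bar operator on an $\mathcal H(W)$-module $M$ free over $\mathcal A$ is an $\mathcal A$-antilinear involution $\psi$ with $\psi(hm)=\overline h\psi(m)$. Given an ordered standard basis $\{m_x\}$ with $\psi(m_x)\in m_x+\sum_{y<x}\mathcal A m_y$, the canonical basis is the (unique) basis with $\psi(C_x)=C_x$ and $C_x\in m_x+\sum_{y<x}v^{-1}\mathbb Z[v^{-1}]m_y$. An integral $W$-graph is a finite set $X$ with labels $\tau(x)\subseteq S$ and integer weights $\mathrm{wt}(x,y)$ such that \[T_sC_x=vC_x\ (s\notin\tau(x)),\qquad T_sC_x=-v^{-1}C_x+\sum_{s\notin\tau(y)}\mathrm{wt}(x,y)C_y\ (s\in\tau(x))\] defines an $\mathcal H(W)$-module on the free $\mathcal A$-module with basis $\{C_x\}$ (an integral $W$-graph module). It is a canonical $W$-graph if $\{C_x\}$ is a canonical basis, i.e. the $W$-graph module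 has a bar operator $\psi$ and an ordered standard basis $\{m_x:x\in X\}$ with $\psi(m_x)\in m_x+\sum_{y<x}\mathcal A m_y$, such that $\psi(C_x)=C_x$ and $C_x\in m_x+\sum_{y<x}v^{-1}\mathbb Z[v^{-1}]m_y$ for all $x\in X$. Specialization means setting $v=1$. A Hecke deformation of a lattice $L$ is an $\mathcal H(W)$-module free over $\mathcal A$ whose specialization is isomorphic to $L$ over $\mathbb ZW$; ''termwise'' means one such module for each term of the model, and ''termwise natural integral canonical $W$-graphs'' means each term's natural lattice is the specialization of a module given by an integral canonical $W$-graph. *)

(* Defs.v *)
From Stdlib Require List.
From HB Require Import structures.
From mathcomp Require Import all_boot all_order all_fingroup all_algebra.
From mathcomp Require Import all_solvable all_field all_character.
From mathcomp Require Import boolp.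

Set Implicit Arguments.
Unset Strict Implicit.
Unset Printing Implicit Defensive.

Import GRing.Theory.

(* [SPerm p e] is the signed permutation i |-> (-1)^(e i) (p i) of the
   coordinates; coordinates 1, 2, 3 are 0, 1, 2 : 'I_3. *)
Record B3 := SPerm { sp_perm : {perm 'I_3}; sp_neg : {ffun 'I_3 -> bool} }.

Definition B3_pair (w : B3) := (sp_perm w, sp_neg w).
Definition pair_B3 (x : {perm 'I_3} * {ffun 'I_3 -> bool}) := SPerm x.1 x.2.
Lemma B3_pairK : cancel B3_pair pair_B3. Proof. by case. Qed.
HB.instance Definition _ := Finite.copy B3 (can_type B3_pairK).

Local Open Scope group_scope.

(* Composition of maps (w first acts by w', then by w); in {perm _}, s * t
   applies s first. *)
Definition B3_mul (w w' : B3) : B3 :=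
  SPerm (sp_perm w' * sp_perm w)
        [ffun i => sp_neg w' i (+) sp_neg w (sp_perm w' i)].
Definition B3_one : B3 := SPerm 1 [ffun=> false].
Definition B3_inv (w : B3) : B3 :=
  SPerm (sp_perm w)^-1 [ffun i => sp_neg w ((sp_perm w)^-1 i)].

Lemma B3_mulA : associative B3_mul.
Proof.
move=> [p e] [q f] [r g]; rewrite /B3_mul /= mulgA; congr SPerm.
by apply/ffunP=> i; rewrite !ffunE /= permM addbA.
Qed.

Lemma B3_mul1 : left_id B3_one B3_mul.
Proof.
move=> [p e]; rewrite /B3_mul /= mulg1; congr SPerm.
by apply/ffunP=> i; rewrite !ffunE addbF.
Qed.

Lemma B3_mulV : left_inverse B3_one B3_inv B3_mul.
Proof.
move=> [p e]; rewrite /B3_mul /B3_inv /= mulgV; congr SPerm.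
by apply/ffunP=> i; rewrite !ffunE permK addbb.
Qed.

HB.instance Definition _ := Finite_isGroup.Build B3 B3_mulA B3_mul1 B3_mulV.

Definition c1 : 'I_3 := @Ordinal 3 0 isT.
Definition c2 : 'I_3 := @Ordinal 3 1 isT.
Definition c3 : 'I_3 := @Ordinal 3 2 isT.

Definition flip (i : 'I_3) : B3 := SPerm 1 [ffun j => j == i].
Definition swap (i j : 'I_3) : B3 := SPerm (tperm i j) [ffun=> false].
Definition negI : B3 := SPerm 1 [ffun=> true].

Definition s0 : B3 := flip c1.
Definition s1 : B3 := swap c1 c2.
Definition s2 : B3 := swap c2 c3.

Definition gen (s : 'I_3) : B3 := nth 1 [:: s0; s1; s2] s.

Local Close Scope group_scope.
Local Open Scope ring_scope.

Record linchar := LinChar {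
  lin_val :> B3 -> int;
  lin_val1 : lin_val 1%g = 1;
  lin_valM : {morph lin_val : x y / (x * y)%g >-> x * y} }.

Lemma triv_proof : {morph (fun=> 1 : int) : x y / (x * y)%g : B3 >-> x * y}.
Proof. by move=> x y; rewrite mulr1. Qed.
Definition chi_triv : linchar := LinChar erefl triv_proof.

Definition delta_val (w : B3) : int := (-1) ^+ odd_perm (sp_perm w).
Lemma delta1 : delta_val 1%g = 1.
Proof. by rewrite /delta_val odd_perm1. Qed.
Lemma deltaM : {morph delta_val : x y / (x * y)%g >-> x * y}.
Proof. by move=> x y; rewrite /delta_val odd_permM signr_addb mulrC. Qed.
Definition delta : linchar := LinChar delta1 deltaM.

Definition eps_val (w : B3) : int := (-1) ^+ #|[set i | sp_neg w i]|.
Lemma eps_valE w : eps_val w = \prod_i (-1) ^+ sp_neg w i.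
Proof.
rewrite /eps_val -prodr_const big_mkcond; apply: eq_bigr => i _.
by rewrite inE; case: (sp_neg w i).
Qed.
Lemma eps1 : eps_val 1%g = 1.
Proof. by rewrite eps_valE big1 // => i _; rewrite ffunE. Qed.
Lemma epsM : {morph eps_val : x y / (x * y)%g >-> x * y}.
Proof.
move=> x y; rewrite !eps_valE.
rewrite [X in _ = X * _](reindex_inj (@perm_inj _ (sp_perm y))) /= -big_split.
by apply: eq_bigr => i _; rewrite ffunE signr_addb mulrC.
Qed.
Definition eps : linchar := LinChar eps1 epsM.

Lemma linmul1 (a b : linchar) : a 1%g * b 1%g = 1.
Proof. by rewrite !lin_val1. Qed.
Lemma linmulM (a b : linchar) :
  {morph (fun w => a w * b w) : x y / (x * y)%g >-> x * y}.
Proof. by move=> x y; rewrite !lin_valM mulrACA. Qed.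
Definition linmul (a b : linchar) : linchar :=
  LinChar (linmul1 a b) (@linmulM a b).

Definition omega : linchar := linmul eps delta.

Lemma linchar_class (H : {group B3}) (sigma : linchar) :
  is_class_fun <<H>>%g [ffun x => ((sigma x)%:~R : algC) *+ (x \in H)].
Proof.
rewrite genGid; apply: intro_class_fun => [x y Hx Hy | x /negbTE -> //].
by rewrite groupJr // /conjg !lin_valM mulrCA -lin_valM mulVg lin_val1 mulr1.
Qed.

Definition lin_cf (H : {group B3}) (sigma : linchar) : 'CF(H) :=
  Cfun 0 (linchar_class H sigma).

(* A term carries its inducing datum (H, sigma|_H). *)
Record term := Term { tgrp : {group B3}; tlin : linchar }.

Definition term_char (t : term) : 'CF([set: B3]) :=
  'Ind[[set: B3]] (lin_cf (tgrp t) (tlin t)).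

Definition term_twist (tau : linchar) (t : term) : term :=
  Term (tgrp t) (linmul tau (tlin t)).

Definition parP : {group B3} := <<[set s1; s2]>>%G.
Definition grpK : {group B3} := (parP <*> <[negI]>)%G.
Definition N3 : {group B3} := <<[set flip c1; flip c2; flip c3]>>%G.

Lemma Wplus_group : group_set [set w | omega w == 1].
Proof.
apply/group_setP; split=> [|x y]; rewrite !inE ?lin_val1 // => /eqP ox /eqP oy.
by rewrite lin_valM ox oy.
Qed.
Definition Wplus : {group B3} := Group Wplus_group.

(* With R the reflection character and U the inflation of the degree 2
   character of S_3, the characters of trm_A tau, trm_B tau, trm_E tau and
   trm_F tau are tau (1 + U), tau (1 + U + R),
   tau (1 + U + R + eps R + delta R) and tau (1 + eps R). *)
Definition trm_A (tau : linchar) := Term (N3 <*> <[swap c1 c2]>)%G tau.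
Definition trm_B (tau : linchar) := Term <<[set s0; s1]>>%G tau.
Definition trm_E (tau : linchar) := Term <<[set s0; s2]>>%G tau.
Definition trm_F (tau : linchar) := Term grpK tau.
Definition trm_C := Term parP chi_triv.
Definition trm_D :=
  Term <<[set swap c1 c2; (flip c1 * flip c2)%g]>>%G chi_triv.
Definition trm_Lp := Term Wplus chi_triv.
Definition trm_Lm := Term Wplus delta.
Definition trm_lin (tau : linchar) := Term [group of [set: B3]] tau.

Definition model := seq term.

Definition perfect_base (i : 'I_4) : model := nth [::]
  [:: [:: trm_C; term_twist delta trm_D];
      [:: trm_C; trm_B delta; trm_B omega];
      [:: trm_B eps; trm_E delta; trm_lin chi_triv; trm_lin omega];
      [:: trm_E omega; trm_B chi_triv; trm_lin delta; trm_lin eps] ] i.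

(* N_i has index i - 1. *)
Definition additional_base (i : 'I_8) : model := nth [::]
  [:: [:: trm_F chi_triv; trm_F eps; trm_B delta; trm_B omega];
      [:: trm_F chi_triv; trm_F eps; term_twist delta trm_D];
      [:: trm_F chi_triv; trm_E delta; trm_A eps; trm_lin omega];
      [:: trm_F chi_triv; trm_E delta; trm_A omega; trm_lin eps];
      [:: trm_B eps; trm_E delta; trm_Lp];
      [:: trm_E omega; trm_F eps; trm_A chi_triv; trm_lin delta];
      [:: trm_E omega; trm_F eps; trm_A delta; trm_lin chi_triv];
      [:: trm_E omega; trm_B chi_triv; trm_Lm] ] i.

Definition omega_twist (b : bool) (M : model) : model :=
  if b then map (term_twist omega) M else M.

(* inl: the eight perfect models, inr: the sixteen additional ones; the boolean
   says whether the omega-twist is taken. *)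
Definition model_index : finType := ('I_4 * bool + 'I_8 * bool)%type.

Definition the_model (k : model_index) : model :=
  match k with
  | inl (i, b) => omega_twist b (perfect_base i)
  | inr (i, b) => omega_twist b (additional_base i)
  end.

Definition model_chars (M : model) : seq 'CF([set: B3]) := map term_char M.

Definition in_model (t : term) (M : model) : Prop := List.In t M.

Definition ZW : zmodType := {ffun B3 -> int}.
Definition zw_delta (w : B3) : ZW := [ffun x => (x == w)%:Z].
Definition zw_lmul (w : B3) (f : ZW) : ZW := [ffun x => f (w^-1 * x)%g].

(* The subgroup of ZW spanned by the elements w h - sigma(h) w, w in W,
   h in H.  As (ZW (x)_Z Z_sigma) = ZW, the quotient of ZW by this subgroup is
   the tensor product of ZW and Z_sigma over ZH. *)
Definition ind_rel (t : term) : {pred ZW} := fun f =>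
  `[< exists c : B3 -> B3 -> int,
        f = \sum_w \sum_(h in tgrp t)
              (zw_delta (w * h)%g - zw_delta w *~ tlin t h) *~ c w h >].

Lemma ind_rel_zmod_closed t : zmod_closed (ind_rel t).
Proof.
split=> [|f g]; rewrite ?unfold_in.
  apply/asboolP; exists (fun _ _ => 0); rewrite big1 // => w _.
  by rewrite big1 // => h _; rewrite mulr0z.
move=> /asboolP[c ->] /asboolP[d ->]; apply/asboolP.
exists (fun w h => c w h - d w h); rewrite -sumrB; apply: eq_bigr => w _.
by rewrite -sumrB; apply: eq_bigr => h _; rewrite mulrzBr.
Qed.

HB.instance Definition _ t :=
  GRing.isZmodClosed.Build ZW (ind_rel t) (ind_rel_zmod_closed t).

Definition natlat (t : term) : zmodType := Quotient.quot (ind_rel t).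
Definition natlat_pi (t : term) : ZW -> natlat t := \pi_(Quotient.quot (ind_rel t))%qT.

Lemma zw_lmul_is_zmod_morphism w : zmod_morphism (zw_lmul w).
Proof. by move=> f g; apply/ffunP=> x; rewrite !ffunE. Qed.
HB.instance Definition _ w :=
  GRing.isZmodMorphism.Build ZW ZW (zw_lmul w) (zw_lmul_is_zmod_morphism w).

Lemma zw_lmul_delta w x : zw_lmul w (zw_delta x) = zw_delta (w * x)%g.
Proof.
by apply/ffunP=> y; rewrite !ffunE -(inj_eq (mulgI w)) mulKVg.
Qed.

Lemma zw_lmul_rel t w f : f \in ind_rel t -> zw_lmul w f \in ind_rel t.
Proof.
rewrite !unfold_in => /asboolP[c ->]; apply/asboolP.
exists (fun x h => c (w^-1 * x)%g h).
rewrite [RHS](reindex_inj (mulgI w)) /= raddf_sum; apply: eq_bigr => x _.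
rewrite raddf_sum; apply: eq_bigr => h _.
by rewrite mulKg raddfMz raddfB raddfMz /= !zw_lmul_delta mulgA.
Qed.

Definition natlat_act (t : term) (w : B3) (x : natlat t) : natlat t :=
  natlat_pi t (zw_lmul w (generic_quotient.repr (x : Quotient.quot (ind_rel t)))).

Lemma natlat_act_pi t w f :
  natlat_act w (natlat_pi t f) = natlat_pi t (zw_lmul w f).
Proof.
apply/eqP; rewrite -Quotient.idealrBE -raddfB; apply: zw_lmul_rel.
by rewrite Quotient.idealrBE reprK.
Qed.

Definition Zfrac := {fraction {poly int}}.

(* Z[v, v^-1] as the subring of Frac(Z[v]) of the fractions p / v^n. *)
Definition laurent_pred : {pred Zfrac} := fun x =>
  `[< exists (p : {poly int}) (n : nat), x * tofrac 'X ^+ n = tofrac p >].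

Lemma tofracX_neq0 n : (tofrac 'X : Zfrac) ^+ n != 0.
Proof. by rewrite expf_neq0 // tofrac_eq0 polyX_eq0. Qed.

Lemma laurent_subring_closed : subring_closed laurent_pred.
Proof.
split=> [|x y|x y]; rewrite !unfold_in.
- by apply/asboolP; exists 1, 0; rewrite mulr1 tofrac1.
- move=> /asboolP[p [n xE]] /asboolP[q [m yE]]; apply/asboolP.
  exists (p * 'X ^+ m - q * 'X ^+ n), (n + m)%N.
  rewrite tofracB !tofracM !tofracXn -xE -yE mulrBl exprD.
  by rewrite mulrA [X in y * X]mulrC mulrA.
- move=> /asboolP[p [n xE]] /asboolP[q [m yE]]; apply/asboolP.
  by exists (p * q), (n + m)%N; rewrite tofracM -xE -yE exprD mulrACA.
Qed.

HB.instance Definition _ :=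
  GRing.isSubringClosed.Build Zfrac laurent_pred laurent_subring_closed.

Record laurent := Laurent { laurent_val :> Zfrac; _ : laurent_val \in laurent_pred }.
HB.instance Definition _ := [isSub for laurent_val].
HB.instance Definition _ := [Choice of laurent by <:].
HB.instance Definition _ := [SubChoice_isSubComNzRing of laurent by <:].

Lemma v_subproof : tofrac 'X \in laurent_pred.
Proof. by rewrite unfold_in; apply/asboolP; exists 'X, 0; rewrite mulr1. Qed.
Definition v : laurent := Laurent v_subproof.

Lemma vV_subproof : (tofrac 'X)^-1 \in laurent_pred.
Proof.
rewrite unfold_in; apply/asboolP; exists 1, 1.
by rewrite expr1 mulVf ?tofrac1 // -[tofrac _]expr1 tofracX_neq0.
Qed.
Definition vV : laurent := Laurent vV_subproof.

Lemma v_vV : v * vV = 1.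
Proof.
by apply: val_inj; rewrite /= mulfV // -[tofrac _]expr1 tofracX_neq0.
Qed.

Lemma laurent_repr (x : laurent) : exists pn : {poly int} * nat,
  laurent_val x * tofrac 'X ^+ pn.2 = tofrac pn.1.
Proof.
by case: x => x /=; rewrite unfold_in => /asboolP[p [n xE]]; exists (p, n).
Qed.
Definition laurent_num (x : laurent) : {poly int} := (projT1 (cid (laurent_repr x))).1.
Definition laurent_den (x : laurent) : nat := (projT1 (cid (laurent_repr x))).2.

(* The value of x at v = u, where u' is the inverse of u. *)
Definition laurent_eval (B : comNzRingType) (u u' : B) (x : laurent) : B :=
  (map_poly intr (laurent_num x)).[u] * u' ^+ laurent_den x.

Section LaurentEval.
Variables (B : comNzRingType) (u u' : B).
Hypothesis uu' : u * u' = 1.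

Lemma laurent_evalE (x : laurent) (p : {poly int}) n :
  laurent_val x * tofrac 'X ^+ n = tofrac p ->
  laurent_eval u u' x = (map_poly intr p).[u] * u' ^+ n.
Proof.
rewrite /laurent_eval /laurent_num /laurent_den.
case: (cid _) => -[q m] /= xq xp.
have E : p * 'X ^+ m = q * 'X ^+ n.
  by apply/eqP; rewrite -tofrac_eq !tofracM !tofracXn -xq -xp mulrAC.
have uK k : u ^+ k * u' ^+ k = 1 by rewrite -exprMn uu' expr1n.
have /(congr1 (fun r => (map_poly intr r : {poly B}).[u])) := E.
rewrite !rmorphM !rmorphXn /= !map_polyX !hornerM !hornerXn => {}E.
rewrite -[LHS]mulr1 -[X in _ * X = _](uK n) mulrACA -E.
by rewrite mulrA -[_ * u ^+ m * _]mulrA uK mulr1.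
Qed.

Lemma laurent_eval_is_zmod_morphism : zmod_morphism (laurent_eval u u').
Proof.
move=> x y; have [[p n] /= xp] := laurent_repr x.
have [[q m] /= yq] := laurent_repr y.
rewrite (laurent_evalE xp) (laurent_evalE yq).
rewrite (@laurent_evalE _ (p * 'X ^+ m - q * 'X ^+ n) (n + m)); last first.
  rewrite tofracB !tofracM !tofracXn -xp -yq /= mulrBl exprD.
  by rewrite !mulrA [laurent_val y * _ * _]mulrAC.
rewrite rmorphB !rmorphM !rmorphXn /= !map_polyX.
rewrite hornerD hornerN !hornerM !hornerXn mulrBl exprD.
have uK k : u ^+ k * u' ^+ k = 1 by rewrite -exprMn uu' expr1n.
congr (_ - _); first by rewrite [u' ^+ n * _]mulrC mulrA -[_ * u ^+ m * _]mulrA uK mulr1.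
by rewrite mulrA -[_ * u ^+ n * _]mulrA uK mulr1.
Qed.

Lemma laurent_eval_is_monoid_morphism : monoid_morphism (laurent_eval u u').
Proof.
split=> [|x y].
  rewrite (@laurent_evalE _ 1 0) ?mulr1 ?tofrac1 //.
  by rewrite rmorph1 hornerE.
have [[p n] /= xp] := laurent_repr x.
have [[q m] /= yq] := laurent_repr y.
rewrite (laurent_evalE xp) (laurent_evalE yq).
rewrite (@laurent_evalE _ (p * q) (n + m)); last first.
  by rewrite tofracM -xp -yq exprD mulrACA.
by rewrite rmorphM hornerM exprD mulrACA.
Qed.

Lemma laurent_eval_v : laurent_eval u u' v = u.
Proof.
by rewrite (@laurent_evalE _ 'X 0) ?mulr1 // map_polyX hornerX.
Qed.

End LaurentEval.

Definition bar : laurent -> laurent := laurent_eval vV v.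
Lemma vV_v : vV * v = 1. Proof. by rewrite mulrC v_vV. Qed.
HB.instance Definition _ := GRing.isZmodMorphism.Build laurent laurent bar
  (laurent_eval_is_zmod_morphism vV_v).
HB.instance Definition _ := GRing.isMonoidMorphism.Build laurent laurent bar
  (laurent_eval_is_monoid_morphism vV_v).
Lemma bar_v : bar v = vV. Proof. exact: laurent_eval_v vV_v. Qed.

Definition at1 : laurent -> int := laurent_eval 1 1.
HB.instance Definition _ := GRing.isZmodMorphism.Build laurent int at1
  (laurent_eval_is_zmod_morphism (mulr1 1)).
HB.instance Definition _ := GRing.isMonoidMorphism.Build laurent int at1
  (laurent_eval_is_monoid_morphism (mulr1 1)).
Lemma at1_v : at1 v = 1. Proof. exact: laurent_eval_v (mulr1 1). Qed.

Definition vV_multiple (c : laurent) : Prop :=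
  exists p : {poly int}, c = vV * (map_poly intr p).[vV].

(* Elements of H(W) are written as expressions in the generators T_s over A;
   H(W) is the algebra of these expressions modulo the relations listed in
   [hecke_module]. *)
Inductive hecke : Type :=
| HScal of laurent
| HT of 'I_3
| HAdd of hecke & hecke
| HMul of hecke & hecke.

Definition a_ : laurent := v - vV.

(* bar T_s = T_s^-1 = T_s - a *)
Fixpoint hecke_bar (h : hecke) : hecke :=
  match h with
  | HScal c => HScal (bar c)
  | HT s => HAdd (HT s) (HScal (- a_))
  | HAdd h1 h2 => HAdd (hecke_bar h1) (hecke_bar h2)
  | HMul h1 h2 => HMul (hecke_bar h1) (hecke_bar h2)
  end.

(* A module free of rank n is given, in a basis, by the matrices of the T_s
   acting on column vectors. *)
Definition hecke_action n := 'I_3 -> 'M[laurent]_n.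

Fixpoint hecke_act n (T : hecke_action n) (h : hecke) : 'M[laurent]_n :=
  match h with
  | HScal c => c%:M
  | HT s => T s
  | HAdd h1 h2 => hecke_act T h1 + hecke_act T h2
  | HMul h1 h2 => hecke_act T h1 *m hecke_act T h2
  end.

Definition i0 : 'I_3 := @Ordinal 3 0 isT.
Definition i1 : 'I_3 := @Ordinal 3 1 isT.
Definition i2 : 'I_3 := @Ordinal 3 2 isT.

Definition hecke_module n (T : hecke_action n) : Prop :=
  [/\ forall s, T s *m T s = 1%:M + a_ *: T s,
      T i0 *m T i1 *m T i0 *m T i1 = T i1 *m T i0 *m T i1 *m T i0,
      T i1 *m T i2 *m T i1 = T i2 *m T i1 *m T i2
    & T i0 *m T i2 = T i2 *m T i0].

Definition bar_operator n (T : hecke_action n)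
    (psi : 'cV[laurent]_n -> 'cV[laurent]_n) : Prop :=
  [/\ forall x y, psi (x + y) = psi x + psi y,
      forall (c : laurent) x, psi (c *: x) = bar c *: psi x,
      involutive psi
    & forall h x,
        psi (hecke_act T h *m x) = hecke_act T (hecke_bar h) *m psi x].

Definition is_basis n (b : 'I_n -> 'cV[laurent]_n) : Prop :=
  forall x, exists! c : {ffun 'I_n -> laurent}, x = \sum_i c i *: b i.

Definition strict_order n (lt : rel 'I_n) : Prop :=
  irreflexive lt /\ transitive lt.

Definition bar_triangular n (psi : 'cV[laurent]_n -> 'cV[laurent]_n)
    (lt : rel 'I_n) (m : 'I_n -> 'cV[laurent]_n) : Prop :=
  forall x, exists r : 'I_n -> laurent,
    psi (m x) = m x + \sum_(y | lt y x) r y *: m y.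

Definition canonical_basis n (psi : 'cV[laurent]_n -> 'cV[laurent]_n)
    (lt : rel 'I_n) (m C : 'I_n -> 'cV[laurent]_n) : Prop :=
  [/\ is_basis C,
      forall x, psi (C x) = C x
    & forall x, exists2 p : 'I_n -> laurent,
        (forall y, vV_multiple (p y))
        & C x = m x + \sum_(y | lt y x) p y *: m y].

Definition has_canonical_basis n (T : hecke_action n)
    (C : 'I_n -> 'cV[laurent]_n) : Prop :=
  exists (psi : 'cV[laurent]_n -> 'cV[laurent]_n) (lt : rel 'I_n)
         (m : 'I_n -> 'cV[laurent]_n),
    [/\ bar_operator T psi, strict_order lt, is_basis m,
        bar_triangular psi lt m & canonical_basis psi lt m C].

(* The ZW-module structure rho of the specialization at v = 1: s acts as T_s. *)
Definition specialization n (T : hecke_action n) (rho : B3 -> 'M[int]_n) : Prop :=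
  [/\ rho 1%g = 1%:M,
      {morph rho : w w' / (w * w')%g >-> w *m w'}
    & forall s, rho (gen s) = map_mx at1 (T s)].

Definition specializes_to n (T : hecke_action n) (t : term) : Prop :=
  exists (rho : B3 -> 'M[int]_n) (phi : 'cV[int]_n -> natlat t),
    [/\ specialization T rho, zmod_morphism phi, bijective phi
      & forall w x, phi (rho w *m x) = natlat_act w (phi x)].

Definition canonical_deformation (t : term) : Prop :=
  exists (n : nat) (T : hecke_action n) (C : 'I_n -> 'cV[laurent]_n),
    [/\ hecke_module T, specializes_to T t & has_canonical_basis T C].

Record wgraph n := WGraph {
  wg_tau : 'I_n -> {set 'I_3};
  wg_wt : 'I_n -> 'I_n -> int }.

Definition std_vec n (x : 'I_n) : 'cV[laurent]_n := delta_mx x 0.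

(* T is the module of the integral W-graph G, with basis C_x = [std_vec x]. *)
Definition wgraph_module n (G : wgraph n) (T : hecke_action n) : Prop :=
  hecke_module T /\
  forall s x, T s *m std_vec x =
    if s \notin wg_tau G x then v *: std_vec x
    else - vV *: std_vec x
         + \sum_(y | s \notin wg_tau G y) (wg_wt G x y)%:~R *: std_vec y.

Definition wgraph_lattice (t : term) : Prop :=
  exists (n : nat) (G : wgraph n) (T : hecke_action n),
    wgraph_module G T /\ specializes_to T t.

Definition canonical_wgraph_lattice (t : term) : Prop :=
  exists (n : nat) (G : wgraph n) (T : hecke_action n),
    [/\ wgraph_module G T, has_canonical_basis T (@std_vec n)
      & specializes_to T t].

Definition termwise_canonical_wgraphs (M : model) : Prop :=
  forall t, in_model t M -> canonical_wgraph_lattice t.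

(* Main.v *)
(* A canonical basis is fixed by the bar operator, and conversely any bar
   invariant basis is canonical for the trivial order and itself as standard
   basis.  So a canonical deformation amounts to matrices c_s = v - T_s over
   Z[v + v^-1] satisfying the Hecke relations; W-graph modules are always of this
   form.  For each term of the models except F_delta, F_eps, L_- and omega L_-
   there is a W-graph, obtained by Kazhdan-Lusztig theory from the standard basis
   of cosets of the (quasi)parabolic subgroup; the twist by omega of a W-graph
   lattice is again one, because the natural lattices are self-dual.  The other
   four terms have deformations found by hand.

   For the obstruction, let X be a W-graph with specialization rho.  As s0 and s2
   commute, an edge from x to y has weight 0 when s0, but not s2, is in tau(x),
   and s2, but not s0, is in tau(y).  Hence rho(s0 s2) has trace n+ - n-, where
   n+ counts the x for which tau(x) contains both or none of s0 and s2, and the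
   reduction of rho(s0) - 1 modulo 2 has rank at most n+ = (n + tr rho(s0 s2)) / 2.
   The natural lattices of the four exceptional terms violate this inequality. *)

Require Import Defs.
From mathcomp Require Import all_boot all_order all_fingroup all_algebra.
From mathcomp Require Import all_solvable all_field all_character.
From mathcomp Require Import boolp.
From HB Require Import structures.
From mathcomp Require Import ring zify.

Set Implicit Arguments.
Unset Strict Implicit.
Unset Printing Implicit Defensive.

Import Order.TTheory GRing.Theory Num.Theory.
Local Open Scope ring_scope.

(* These names of Defs are shadowed by those of burnside_app. *)
Local Notation s0 := Defs.s0.
Local Notation s1 := Defs.s1.
Local Notation s2 := Defs.s2.
Local Notation c1 := Defs.c1.
Local Notation c2 := Defs.c2.
Local Notation c3 := Defs.c3.

(** * Matrices of polynomials *)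

(* Lists of coefficients, the constant one first, and matrices of these as lists
   of rows: fractions of polynomials and matrices do not compute. *)
Section PolynomialLists.

Definition padd : seq int -> seq int -> seq int :=
  fix padd p q := match p, q with
  | [::], _ => q
  | _, [::] => p
  | a :: p', b :: q' => (a + b) :: padd p' q'
  end.
Definition popp (p : seq int) : seq int := [seq - a | a <- p].
Definition pmul (p q : seq int) : seq int :=
  foldr (fun a r => padd [seq a * b | b <- q] (0 :: r)) [::] p.
Definition pzero (p : seq int) : bool := all (fun a => a == 0) p.
Definition pmon n (a : int) : seq int := rcons (nseq n 0) a.

Definition peval (R : comNzRingType) (x : R) (p : seq int) : R :=
  foldr (fun a r => a%:~R + x * r) 0 p.

Lemma peval_add (R : comNzRingType) (x : R) p q :
  peval x (padd p q) = peval x p + peval x q.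
Proof.
elim: p q => [|a p IH] [|b q] /=; rewrite ?add0r ?addr0 // IH rmorphD /=.
by ring.
Qed.

Lemma peval_scale (R : comNzRingType) (x : R) a p :
  peval x [seq a * b | b <- p] = a%:~R * peval x p.
Proof. by elim: p => [|b p IH] /=; rewrite ?mulr0 // IH rmorphM /=; ring. Qed.

Lemma peval_opp (R : comNzRingType) (x : R) p : peval x (popp p) = - peval x p.
Proof. by elim: p => [|b p IH] /=; rewrite ?oppr0 // IH rmorphN /=; ring. Qed.

Lemma peval_mul (R : comNzRingType) (x : R) p q :
  peval x (pmul p q) = peval x p * peval x q.
Proof.
elim: p => [|a p IH] /=; rewrite ?mul0r // peval_add peval_scale /= IH.
by ring.
Qed.

Lemma peval_zero (R : comNzRingType) (x : R) p : pzero p -> peval x p = 0.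
Proof.
by elim: p => //= a p IH /andP[/eqP-> /IH->]; rewrite mulr0 addr0.
Qed.

Lemma peval_eq (R : comNzRingType) (x : R) p q :
  pzero (padd p (popp q)) -> peval x p = peval x q.
Proof.
by move=> /(peval_zero x); rewrite peval_add peval_opp => /subr0_eq.
Qed.

Lemma peval_rmorph (R S : comNzRingType) (f : {rmorphism R -> S}) x p :
  f (peval x p) = peval (f x) p.
Proof.
elim: p => [|a p IH] /=; first exact: rmorph0.
by rewrite rmorphD rmorphM rmorph_int IH.
Qed.

Lemma peval_rcons (R : comNzRingType) (x : R) p a :
  peval x (rcons p a) = peval x p + a%:~R * x ^+ size p.
Proof.
elim: p => [|b p IH] /=; first by rewrite mulr0 addr0 mulr1 add0r.
by rewrite IH exprS; ring.
Qed.

Lemma peval_mon (R : comNzRingType) (x : R) n a :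
  peval x (pmon n a) = a%:~R * x ^+ n.
Proof.
rewrite peval_rcons size_nseq peval_zero ?add0r //.
by rewrite /pzero all_nseq eqxx orbT.
Qed.

(** Reversing a list of n + 1 coefficients is p(x) -> x^n p(1/x); on lists this computes the bar
    involution. *)
Lemma peval_inv (R : comNzRingType) (x y : R) p n :
  x * y = 1 -> size p = n.+1 -> x ^+ n * peval y p = peval x (rev p).
Proof.
move=> xy; elim: p n => // a p IH [|n] [sp].
  by rewrite (size0nil sp) /=; ring.
rewrite rev_cons peval_rcons size_rev sp -(IH n) //= exprS.
(* The zero x^n p(y) - x^n p(y) is inserted with one factor 1 written as x y, which leaves an
   identity valid in every commutative ring. *)
by rewrite -[RHS]add0r -(subrr (x ^+ n * peval y p)) -{2}[peval y p]mul1r -xy; ring.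
Qed.

Lemma peval_pad (R : comNzRingType) (x : R) p n :
  peval x (p ++ nseq n 0) = peval x p.
Proof.
elim: p => [|a p IH] /=; last by rewrite IH.
by elim: n => //= n ->; rewrite mulr0 addr0.
Qed.

Lemma foldr_padd (R : comNzRingType) (x : R) (s : seq (seq int)) :
  peval x (foldr padd [::] s) = \sum_(p <- s) peval x p.
Proof. by elim: s => [|p s IH]; rewrite ?big_nil //= peval_add IH big_cons. Qed.

End PolynomialLists.

Definition pmat := seq (seq (seq int)).
Definition ent (A : pmat) i j : seq int := nth [::] (nth [::] A i) j.
Definition mkmat m n (f : nat -> nat -> seq int) : pmat :=
  mkseq (fun i => mkseq (f i) n) m.
Definition pmulmx m k n (A B : pmat) : pmat :=
  mkmat m n (fun i j =>
    foldr padd [::] [seq pmul (ent A i l) (ent B l j) | l <- iota 0 k]).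
Definition pscalar n (p : seq int) : pmat :=
  mkmat n n (fun i j => if i == j then p else [::]).
Definition paddmx m n (A B : pmat) : pmat :=
  mkmat m n (fun i j => padd (ent A i j) (ent B i j)).
Definition ptrmx m n (A : pmat) : pmat := mkmat m n (fun i j => ent A j i).
Definition pscalemx m n p (A : pmat) : pmat :=
  mkmat m n (fun i j => pmul p (ent A i j)).
Definition peqmx m n (A B : pmat) : bool :=
  all (fun i => all (fun j => pzero (padd (ent A i j) (popp (ent B i j))))
                    (iota 0 n)) (iota 0 m).
(** The value at v = 1, kept as a matrix of constant polynomials. *)
Definition pmx1 m n (A : pmat) : pmat :=
  mkmat m n (fun i j => [:: foldr +%R 0 (ent A i j)]).

Definition pmx (R : comNzRingType) (x : R) m n (A : pmat) : 'M[R]_(m, n) :=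
  \matrix_(i, j) peval x (ent A i j).

Section PolynomialMatrices.
Variables (R : comNzRingType) (x : R).

Lemma ent_mkmat m n f i j : (i < m)%N -> (j < n)%N -> ent (mkmat m n f) i j = f i j.
Proof. by move=> im jn; rewrite /ent /mkmat !nth_mkseq. Qed.

Lemma pmx_mul m k n A B :
  pmx x m n (pmulmx m k n A B) = pmx x m k A *m pmx x k n B.
Proof.
apply/matrixP=> i j; rewrite !mxE ent_mkmat // foldr_padd big_map.
rewrite -[k in iota 0 k]subn0 [LHS]big_mkord; apply: eq_bigr => l _.
by rewrite peval_mul !mxE.
Qed.

Lemma pmx_scalar n p : pmx x n n (pscalar n p) = (peval x p)%:M.
Proof. by apply/matrixP=> i j; rewrite !mxE ent_mkmat // -val_eqE; case: eqP. Qed.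

Lemma pmx_add m n A B : pmx x m n (paddmx m n A B) = pmx x m n A + pmx x m n B.
Proof. by apply/matrixP=> i j; rewrite !mxE ent_mkmat // peval_add. Qed.

Lemma pmx_scale m n p A :
  pmx x m n (pscalemx m n p A) = peval x p *: pmx x m n A.
Proof. by apply/matrixP=> i j; rewrite !mxE ent_mkmat // peval_mul. Qed.

Lemma pmx_eq m n A B : peqmx m n A B -> pmx x m n A = pmx x m n B.
Proof.
move=> /allP AB; apply/matrixP=> i j; rewrite !mxE; apply: peval_eq.
have /AB /allP -> // : (i : nat) \in iota 0 m by rewrite mem_iota /=.
by rewrite mem_iota /=.
Qed.

End PolynomialMatrices.

Lemma pmx1E m n A : pmx (1 : int) m n (pmx1 m n A) = pmx 1 m n A.
Proof.
apply/matrixP=> i j; rewrite !mxE ent_mkmat //= mulr0 addr0.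
by elim: (ent A i j) => //= a p <-; rewrite mul1r !intz.
Qed.

(** * Words in the generators *)

Definition word := seq nat.
Definition genn (k : nat) : B3 := nth 1%g [:: s0; s1; s2] k.
Definition ev (w : word) : B3 := foldr (fun k x => (genn k * x)%g) 1%g w.

(* The images of the three positive unit vectors, the vectors e_i and -e_i
   being numbered 2 i and 2 i + 1. *)
Definition code (x : B3) : seq nat :=
  [seq ((sp_perm x i).*2 + sp_neg x i)%N | i <- [:: c1; c2; c3]].
(** The k-th generator as a permutation of the six vectors. The lists stop after the last point
    moved, and the default of [nth] fixes the rest; letters k > 2 act trivially, like [genn k]. *)
Definition cact (k a : nat) : nat :=
  nth a (nth [::] [:: [:: 1; 0]; [:: 2; 3; 0; 1]; [:: 0; 1; 4; 5; 2; 3]] k) a.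
Definition cw (w : word) : seq nat :=
  foldr (fun k c => map (cact k) c) [:: 0; 2; 4]%N w.

Lemma ord3P (P : 'I_3 -> Prop) : P c1 -> P c2 -> P c3 -> forall i, P i.
Proof.
move=> P1 P2 P3 [[|[|[|//]]] i3].
- by rewrite (_ : Ordinal i3 = c1) //; apply: val_inj.
- by rewrite (_ : Ordinal i3 = c2) //; apply: val_inj.
- by rewrite (_ : Ordinal i3 = c3) //; apply: val_inj.
Qed.

Lemma code_inj : injective code.
Proof.
have splitE (a b : nat) (e f : bool) : (a.*2 + e = b.*2 + f)%N -> a = b /\ e = f.
  move=> E; have := congr1 odd E; rewrite !oddD !odd_double !oddb /= => ef.
  by move: E; rewrite ef => /addIn/double_inj.
move=> [p e] [q f] /= [] /splitE[p1 e1] /splitE[p2 e2] /splitE[p3 e3].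
congr SPerm.
  by apply/permP; apply: ord3P; apply: val_inj.
by apply/ffunP; apply: ord3P.
Qed.

Lemma code1 : code 1%g = [:: 0; 2; 4]%N.
Proof. by rewrite /code /= !perm1 !ffunE. Qed.

Lemma code_genn k x : code (genn k * x)%g = map (cact k) (code x).
Proof.
rewrite /code -map_comp; apply: eq_map => i /=.
have cactE (j : 'I_3) (b : bool) :
  ((sp_perm (genn k) j).*2 + (b (+) sp_neg (genn k) j))%N
  = cact k (j.*2 + b)%N.
  case: k => [|[|[|k]]]; rewrite /= ?nth_nil ?perm1 ?ffunE ?addbF //.
  - by move: j; apply: ord3P; rewrite ?addbF; case: b.
  - move: j; apply: ord3P; rewrite ?tpermL ?tpermR ?tpermD //; by case: b.
  - move: j; apply: ord3P; rewrite ?tpermL ?tpermR ?tpermD //; by case: b.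
  - move: j; apply: ord3P; rewrite /cact; case: k => [|k] /=;
    by rewrite ?perm1 ?ffunE; case: b.
by rewrite /= permM ffunE cactE.
Qed.

Lemma code_ev w : code (ev w) = cw w.
Proof. by elim: w => [|k w IH]; rewrite ?code1 //= code_genn IH. Qed.

Lemma ev_cat u w : ev (u ++ w) = (ev u * ev w)%g.
Proof. by elim: u => [|k u IH] /=; rewrite ?mul1g // IH mulgA. Qed.

Lemma ev_eq u w : (ev u == ev w) = (cw u == cw w).
Proof. by rewrite -!code_ev (inj_eq code_inj). Qed.

Lemma eq_ev x w : code x = cw w -> x = ev w.
Proof. by rewrite -code_ev => /code_inj. Qed.

Definition codes (L : seq word) := [seq cw w | w <- L].

Definition span_add (L : seq word) w := if cw w \in codes L then L else rcons L w.
(** One word for each element reached in nine rounds, 9 being the length of the longest element of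
    W. That nothing is missing is not assumed: [closedw] checks it. *)
Definition span (gens : seq word) : seq word :=
  iter 9 (fun L => foldl span_add L [seq g ++ l | g <- gens, l <- L]) [:: [::]].

Lemma span_ind (P : word -> Prop) gens :
    P [::] -> (forall g l, g \in gens -> P l -> P (g ++ l)) ->
  forall w, w \in span gens -> P w.
Proof.
move=> P0 Pg; rewrite /span; elim: 9%N => [|n IH] w /=.
  by rewrite inE => /eqP->.
set L := iter n _ _ in IH *.
have : forall u, u \in [seq g ++ l | g <- gens, l <- L] -> P u.
  by move=> u /allpairsP[[g l] /= [gg /IH lL ->]]; apply: Pg.
move: [seq g ++ l | g <- gens, l <- L] => s.
elim/last_ind: s w => [|s u IHs] w Ps /=; first exact: IH.
rewrite foldl_rcons /span_add; case: ifP => _ => [|].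
  by apply: IHs => // u' u's; apply: Ps; rewrite mem_rcons inE u's orbT.
rewrite mem_rcons inE => /orP[/eqP->|].
  by apply: Ps; rewrite mem_rcons mem_head.
by apply: IHs => // u' u's; apply: Ps; rewrite mem_rcons inE u's orbT.
Qed.

Lemma mem_span (G : {group B3}) gens :
    (forall g, g \in gens -> ev g \in G) ->
  forall w, w \in span gens -> ev w \in G.
Proof.
move=> genG; apply: span_ind => [|g l /genG gG lG]; first exact: group1.
by rewrite ev_cat groupM.
Qed.

Definition closedw (L : seq word) : bool :=
  let C := codes L in
  (cw [::] \in C) && all (fun u => all (fun w => cw (u ++ w) \in C) L) L.

Lemma closedw_group L : closedw L -> group_set [set x | code x \in codes L].
Proof.
move=> /andP[L1 /allP LM]; apply/group_setP; split=> [|x y]; rewrite !inE.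
  by rewrite code1.
move=> /mapP[u uL /eq_ev->] /mapP[w wL /eq_ev->].
by rewrite -ev_cat code_ev; have /allP -> := LM u uL.
Qed.

(** Words in the generators stay in G; conversely a closed list of codes describes a group, which
    contains G as soon as it contains the generators. *)
Lemma span_mem (G : {group B3}) gens L x :
    G :=: <<[set y in map ev gens]>>%g -> L = span gens -> closedw L ->
    all (fun g => cw g \in codes L) gens ->
  (x \in G) = (code x \in codes L).
Proof.
move=> Ggen Lgens cl /allP genL; apply/idP/idP.
  have -> : (code x \in codes L) = (x \in Group (closedw_group cl)).
    by rewrite inE.
  apply: subsetP; rewrite Ggen gen_subG; apply/subsetP=> y.
  by rewrite !inE => /mapP[g gg ->]; rewrite code_ev genL.
move=> /mapP[w + /eq_ev->]; rewrite Lgens => wL; apply: mem_span wL => g gg.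
by rewrite Ggen mem_gen // inE map_f.
Qed.

(** * The inducing subgroups as lists of words *)

Definition grp_gens : seq (seq word) :=
  [:: [:: [:: 0]; [:: 1; 0; 1]; [:: 2; 1; 0; 1; 2]; [:: 1]];
      [:: [:: 0]; [:: 1]];
      [:: [:: 0]; [:: 2]];
      [:: [:: 1]; [:: 2]; [:: 0; 1; 0; 1; 2; 1; 0; 1; 2]];
      [:: [:: 1]; [:: 2]];
      [:: [:: 1]; [:: 0; 1; 0; 1]];
      [:: [:: 0; 1]; [:: 1; 2]];
      [:: [:: 0]; [:: 1]; [:: 2]] ]%N.
Definition grps : seq {group B3} :=
  [:: N3 <*> <[swap c1 c2]>; <<[set s0; s1]>>; <<[set s0; s2]>>; grpK; parP;
      <<[set swap c1 c2; (flip c1 * flip c2)%g]>>; Wplus;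
      [group of [set: B3]] ]%G.
Definition grp_words : seq (seq word) := Eval vm_compute in map span grp_gens.
Definition gwords k : seq word := nth [::] grp_words k.

Lemma grp_wordsE : grp_words = map span grp_gens.
Proof. by vm_compute. Qed.

Lemma grp_words_closed : all closedw grp_words.
Proof. by vm_compute. Qed.

Lemma flip2E : flip c2 = ev [:: 1; 0; 1]%N.
Proof. by apply: eq_ev; rewrite /code /= !perm1 !ffunE. Qed.

Lemma flip12E : (flip c1 * flip c2)%g = ev [:: 0; 1; 0; 1]%N.
Proof. by rewrite flip2E /= mulgA. Qed.

Lemma flip3E : flip c3 = ev [:: 2; 1; 0; 1; 2]%N.
Proof. by apply: eq_ev; rewrite /code /= !perm1 !ffunE. Qed.

Lemma negIE : negI = ev [:: 0; 1; 0; 1; 2; 1; 0; 1; 2]%N.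
Proof. by apply: eq_ev; rewrite /code /= !perm1 !ffunE. Qed.

Lemma genE k : genn k = ev [:: k].
Proof. by rewrite /= mulg1. Qed.

Lemma linchar_ev (a : linchar) w : a (ev w) = \prod_(k <- w) a (genn k).
Proof.
by elim: w => [|k w IH]; rewrite ?big_nil ?big_cons /= ?lin_val1 // lin_valM IH.
Qed.

Lemma omega_gens : [/\ omega s0 = -1, omega s1 = -1 & omega s2 = -1].
Proof.
rewrite /omega /= /eps_val /delta_val odd_perm1 !odd_tperm.
have -> : [set i | sp_neg s0 i] = [set c1].
  by apply/setP=> i; rewrite !inE ffunE.
have -> : [set i | sp_neg s1 i] = set0.
  by apply/setP=> i; rewrite !inE ffunE.
by rewrite cards1 cards0.
Qed.

(** The codes of W are the triples of vectors on three distinct axes, so this checks exhaustion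
    without enumerating the type [B3]. *)
Definition covers (C : seq (seq nat)) : bool :=
  all (fun a => all (fun b => all (fun c =>
    uniq [:: a./2; b./2; c./2] ==> ([:: a; b; c] \in C))
    (iota 0 6)) (iota 0 6)) (iota 0 6).

Lemma code_W x : code x \in codes (gwords 7).
Proof.
have : covers (codes (gwords 7)) by vm_compute.
have lt6 i : ((sp_perm x i).*2 + sp_neg x i)%N \in iota 0 6.
  rewrite mem_iota /=; have := ltn_ord (sp_perm x i).
  by case: (sp_perm x i) => [[|[|[|]]]] //= _; case: (sp_neg x i).
have half i : ((sp_perm x i).*2 + sp_neg x i)%N./2 = sp_perm x i.
  by rewrite addnC half_bit_double.
move=> /allP/(_ _ (lt6 c1))/allP/(_ _ (lt6 c2))/allP/(_ _ (lt6 c3)).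
rewrite !half; move=> /implyP; apply.
by rewrite /= !inE !(inj_eq val_inj) !(inj_eq perm_inj).
Qed.

Lemma ev_W x : exists2 w, w \in gwords 7 & x = ev w.
Proof. by have /mapP[w wL /eq_ev xw] := code_W x; exists w. Qed.

(** This group is defined as a kernel, not by generators. As [omega] is -1 on each generator,
    membership is the parity of the length of a word. *)
Lemma mem_Wplus x : (x \in Wplus) = (code x \in codes (gwords 6)).
Proof.
have [O0 O1 O2] := omega_gens.
have ow w : w \in gwords 7 -> omega (ev w) = (-1) ^+ size w.
  move=> wW; rewrite linchar_ev; have : all (fun k => k < 3)%N w.
    by apply: allP w wW; vm_compute.
  elim: w {wW} => [|k w IH] /=; first by rewrite big_nil.
  move=> /andP[k3 /IH IHw]; rewrite big_cons IHw exprS; congr (_ * _).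
  by case: k k3 => [|[|[|]]].
have [w wW ->] := ev_W x.
have : all (fun w => (cw w \in codes (gwords 6)) == ~~ odd (size w)) (gwords 7).
  by vm_compute.
move=> /allP/(_ w wW)/eqP; rewrite code_ev => ->.
rewrite (_ : (ev w \in Wplus) = (omega (ev w) == 1)) ?inE //.
by rewrite ow // -signr_odd; case: (odd _).
Qed.

Lemma mem_grps k x :
  (k < 8)%N -> (x \in nth 1%G grps k) = (code x \in codes (gwords k)).
Proof.
move=> k8; have sz : size grp_words = 8%N by [].
have cl : closedw (gwords k) by rewrite (allP grp_words_closed) ?mem_nth ?sz.
have eL : gwords k = span (nth [::] grp_gens k).
  by rewrite /gwords grp_wordsE (nth_map [::]).
have aL : all (fun g => cw g \in codes (gwords k)) (nth [::] grp_gens k).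
  have : all2 (fun gens L => all (fun g => cw g \in codes L) gens) grp_gens grp_words.
    by vm_compute.
  rewrite all2E => /andP[_ /(all_nthP ([::], [::]))/(_ k)].
  by rewrite size_zip nth_zip //; apply.
move: cl eL aL; case: k k8 => [|[|[|[|[|[|[|[|//]]]]]]]] _ cl eL aL.
- apply: span_mem eL cl aL; rewrite /= joing_idl joing_idr.
  by congr <<_>>%g; apply/setP=> y; rewrite !inE flip2E flip3E /= !mulg1 !orbA.
- apply: span_mem eL cl aL; rewrite /= !mulg1.
  by congr <<_>>%g; apply/setP=> y; rewrite !inE.
- apply: span_mem eL cl aL; rewrite /= !mulg1.
  by congr <<_>>%g; apply/setP=> y; rewrite !inE.
- apply: span_mem eL cl aL; rewrite /= joing_idl joing_idr.
  by congr <<_>>%g; apply/setP=> y; rewrite !inE negIE /= !mulg1 !orbA.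
- apply: span_mem eL cl aL; rewrite /= !mulg1.
  by congr <<_>>%g; apply/setP=> y; rewrite !inE.
- apply: span_mem eL cl aL; rewrite /= flip12E /= !mulg1.
  by congr <<_>>%g; apply/setP=> y; rewrite !inE.
- exact: mem_Wplus.
- by rewrite inE code_W.
Qed.

(** * Natural lattices *)

(* (k, (b, b')) stands for the k-th group in [grps], with the linear character
   taking the value (-1)^b on s0 and (-1)^b' on s1 and s2. *)
Definition sterm := (nat * (bool * bool))%type.

Definition denotes (t : term) (d : sterm) : Prop :=
  [/\ (d.1 < 8)%N, tgrp t = nth 1%G grps d.1, tlin t s0 = (-1) ^+ d.2.1,
      tlin t s1 = (-1) ^+ d.2.2 & tlin t s2 = (-1) ^+ d.2.2].

Definition sgw (b : bool * bool) (w : word) : int :=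
  foldr (fun k r => match k with
    | 0%N => if b.1 then - r else r
    | 1%N | 2%N => if b.2 then - r else r
    | _ => r end) 1 w.

Lemma tlin_ev t d w : denotes t d -> tlin t (ev w) = sgw d.2 w.
Proof.
case=> _ _ t0 t1 t2; elim: w => [|k w IH] /=; first exact: lin_val1.
rewrite lin_valM IH; case: k => [|[|[|k]]] /=.
- by rewrite t0; case: d.2.1; rewrite ?mulN1r ?mul1r.
- by rewrite t1; case: d.2.2; rewrite ?mulN1r ?mul1r.
- by rewrite t2; case: d.2.2; rewrite ?mulN1r ?mul1r.
- by rewrite /genn nth_default // lin_val1 mul1r.
Qed.

Lemma gwords_uniq k : uniq (codes (gwords k)).
Proof.
have [k8|k8] := ltnP k 8; last by rewrite /gwords nth_default.
have : all (fun L => uniq (codes L)) grp_words by vm_compute.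
by move=> /all_nthP -> //; rewrite -[size _]/8%N.
Qed.

Lemma sum_grp (R : nmodType) t d (F : B3 -> R) : denotes t d ->
  \sum_(h in tgrp t) F h = \sum_(l <- gwords d.1) F (ev l).
Proof.
case=> k8 -> _ _ _; rewrite -(big_map ev xpredT) -big_enum.
have uL : uniq (map ev (gwords d.1)).
  by rewrite -(map_inj_uniq code_inj) -map_comp (eq_map code_ev) gwords_uniq.
apply: perm_big; apply: uniq_perm; rewrite ?enum_uniq // => x.
rewrite mem_enum mem_grps //.
apply/mapP/mapP=> [[w wL /eq_ev->]|[w wL ->]]; exists w => //.
by rewrite code_ev.
Qed.

Lemma mulmx_col_inj m n (A B : 'M[int]_(m, n)) :
  (forall y : 'cV_n, A *m y = B *m y) -> A = B.
Proof.
move=> AB; apply/matrixP=> i j.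
by have /colP/(_ i) := AB (delta_mx j 0); rewrite -!colE !mxE.
Qed.

Section NaturalLattice.
Variable t : term.

Lemma natlat_pi_is_zmod_morphism : zmod_morphism (natlat_pi t).
Proof. exact: (raddfB (\pi_(Quotient.quot (ind_rel t))%qT)). Qed.
HB.instance Definition _ := GRing.isZmodMorphism.Build ZW (natlat t)
  (natlat_pi t) natlat_pi_is_zmod_morphism.

Lemma natlat_piP x : exists f, x = natlat_pi t f.
Proof.
exists (generic_quotient.repr (x : Quotient.quot (ind_rel t))).
by rewrite /natlat_pi reprK.
Qed.

Lemma natlat_pi_rel f g : f - g \in ind_rel t -> natlat_pi t f = natlat_pi t g.
Proof. by rewrite Quotient.idealrBE => /eqP. Qed.

Lemma natlat_act_is_zmod_morphism w : zmod_morphism (@natlat_act t w).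
Proof.
move=> x y; have [f ->] := natlat_piP x; have [g ->] := natlat_piP y.
by rewrite -raddfB !natlat_act_pi !raddfB.
Qed.
HB.instance Definition _ w := GRing.isZmodMorphism.Build (natlat t) (natlat t)
  (@natlat_act t w) (natlat_act_is_zmod_morphism w).

Lemma natlat_act1 (x : natlat t) : natlat_act 1%g x = x.
Proof.
have [f ->] := natlat_piP x; rewrite natlat_act_pi; congr natlat_pi.
by apply/ffunP=> y; rewrite ffunE invg1 mul1g.
Qed.

Lemma natlat_actM w w' (x : natlat t) :
  natlat_act (w * w')%g x = natlat_act w (natlat_act w' x).
Proof.
have [f ->] := natlat_piP x; rewrite !natlat_act_pi; congr natlat_pi.
by apply/ffunP=> y; rewrite !ffunE invMg mulgA.
Qed.

Lemma zw_sum_delta (f : ZW) : f = \sum_w zw_delta w *~ f w.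
Proof.
apply/ffunP=> x; rewrite sum_ffunE (bigD1 x) //= big1 => [|y yx].
  by rewrite ffunMzE ffunE eqxx addr0 -mulrzr mul1r intz.
by rewrite ffunMzE ffunE eq_sym (negPf yx) mul0rz.
Qed.

Lemma natlat_pi_mulr w h : h \in tgrp t ->
  natlat_pi t (zw_delta (w * h)%g) = natlat_pi t (zw_delta w) *~ tlin t h.
Proof.
move=> Hh; rewrite -raddfMz; apply: natlat_pi_rel; rewrite unfold_in.
apply/asboolP; exists (fun w' h' => ((w' == w) && (h' == h))%:Z).
pose F w' h' := zw_delta (w' * h')%g - zw_delta w' *~ tlin t h'.
have inner w' : \sum_(h' in tgrp t) F w' h' *~ ((w' == w) && (h' == h))%:Z
    = if w' == w then F w h else 0.
  have [->|_] := eqVneq w' w; last by rewrite big1 // => h' _; rewrite mulr0z.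
  rewrite (bigD1 h Hh) !eqxx mulr1z big1 => [|h' /andP[_ /negPf->]].
    exact: addr0.
  by rewrite mulr0z.
by rewrite (eq_bigr _ (fun w' _ => inner w')) -big_mkcond big_pred1_eq.
Qed.

(* The coordinates of the isomorphism from the induced to the coinduced
   module. *)
Definition lam (u : B3) (f : ZW) : int := \sum_(h in tgrp t) f (u * h)%g * tlin t h.

Lemma lam_is_zmod_morphism u : zmod_morphism (lam u).
Proof.
move=> f g; rewrite /lam -sumrB; apply: eq_bigr => h _.
by rewrite !ffunE mulrBl.
Qed.
HB.instance Definition _ u := GRing.isZmodMorphism.Build ZW int (lam u)
  (lam_is_zmod_morphism u).

Lemma lam_delta u w :
  lam u (zw_delta w) = \sum_(h in tgrp t) (u * h == w)%g%:Z * tlin t h.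
Proof. by apply: eq_bigr => h _; rewrite ffunE. Qed.

(** Substituting x h for the summation variable x extracts the factor sigma(h), so [lam u] takes at
    w h the value sigma(h) times its value at w. *)
Lemma lam_rel u f : f \in ind_rel t -> lam u f = 0.
Proof.
rewrite unfold_in => /asboolP[c ->]; rewrite raddf_sum big1 // => w _.
rewrite raddf_sum big1 // => h Hh; rewrite raddfMz raddfB raddfMz /= !lam_delta.
rewrite (reindex_inj (mulIg h)) /= (_ : _ - _ = 0) ?mul0rz //.
apply/eqP; rewrite subr_eq0 -mulrzr intz mulr_suml; apply/eqP.
apply: eq_big => [x|x _]; first by rewrite groupMr.
by rewrite mulgA (inj_eq (mulIg h)) lin_valM mulrA.
Qed.

Definition lamq u (x : natlat t) : int :=
  lam u (generic_quotient.repr (x : Quotient.quot (ind_rel t))).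

Lemma lamq_pi u f : lamq u (natlat_pi t f) = lam u f.
Proof.
apply/eqP; rewrite -subr_eq0 /lamq -raddfB /=; apply/eqP; apply: lam_rel.
by rewrite Quotient.idealrBE reprK.
Qed.

Lemma lamq_is_zmod_morphism u : zmod_morphism (lamq u).
Proof.
move=> x y; have [f ->] := natlat_piP x; have [g ->] := natlat_piP y.
by rewrite -raddfB !lamq_pi raddfB.
Qed.
HB.instance Definition _ u := GRing.isZmodMorphism.Build (natlat t) int (lamq u)
  (lamq_is_zmod_morphism u).

Section Transversal.
Variables (n : nat) (r : 'I_n -> B3).

(** The monomial matrix of x on the induced lattice: the entry is sigma(h) if x r_i = r_j h with h
    in H, and 0 otherwise. Its being 1 at x = 1 expresses that the cosets r_i H are distinct. *)
Definition cosetmx (x : B3) : 'M[int]_n :=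
  \matrix_(j, i) \sum_(h in tgrp t) (r j * h == x * r i)%g%:Z * tlin t h.

Hypothesis r_free : cosetmx 1%g = 1%:M.
Hypothesis r_cover : forall x, exists i h, h \in tgrp t /\ x = (r i * h)%g.

Definition coset_sum (y : 'cV[int]_n) : natlat t :=
  \sum_i natlat_pi t (zw_delta (r i)) *~ y i 0.

Lemma coset_sum_is_zmod_morphism : zmod_morphism coset_sum.
Proof.
by move=> x y; rewrite -sumrB; apply: eq_bigr => i _; rewrite !mxE mulrzBr.
Qed.
HB.instance Definition _ := GRing.isZmodMorphism.Build 'cV[int]_n (natlat t)
  coset_sum coset_sum_is_zmod_morphism.

Definition lamv (x : natlat t) : 'cV[int]_n := \col_j lamq (r j) x.

Lemma lamv_act x y : lamv (natlat_act x (coset_sum y)) = cosetmx x *m y.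
Proof.
apply/colP=> j; rewrite !mxE !raddf_sum; apply: eq_bigr => i _.
rewrite !raddfMz /= natlat_act_pi lamq_pi zw_lmul_delta lam_delta !mxE.
by rewrite -mulrzr intz.
Qed.

Lemma lamvK : cancel coset_sum lamv.
Proof. by move=> y; rewrite -[coset_sum y]natlat_act1 lamv_act r_free mul1mx. Qed.

Lemma coset_sum_surj x : exists y, x = coset_sum y.
Proof.
have [f ->] := natlat_piP x; rewrite (zw_sum_delta f) raddf_sum.
elim/big_ind: _ => [|_ _ [y ->] [z ->]|w _].
- by exists 0; rewrite raddf0.
- by exists (y + z); rewrite raddfD.
have [i [h [Hh ->]]] := r_cover w.
exists (delta_mx i 0 *~ (tlin t h * f (r i * h)%g)); rewrite !raddfMz /=.
rewrite natlat_pi_mulr // -mulrzA; congr (_ *~ _).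
rewrite /coset_sum (bigD1 i) //= big1 => [|j ji].
  by rewrite mxE !eqxx addr0.
by rewrite mxE (negPf ji) mulr0z.
Qed.

Lemma coset_sumK : cancel lamv coset_sum.
Proof. by move=> x; have [y ->] := coset_sum_surj x; rewrite lamvK. Qed.

Lemma coset_sum_act x y :
  natlat_act x (coset_sum y) = coset_sum (cosetmx x *m y).
Proof. by rewrite -lamv_act coset_sumK. Qed.

Lemma cosetmxM : {morph cosetmx : x y / (x * y)%g >-> x *m y}.
Proof.
move=> x y; apply: mulmx_col_inj => z; apply: (can_inj lamvK).
by rewrite -mulmxA -!coset_sum_act natlat_actM.
Qed.

(** G takes the basis of the deformation at v = 1 to the coset basis. Conjugating [cosetmx] by it
    defines the action of all of W, so no relation of W has to be checked. *)
Lemma specializes_coset (T : hecke_action n) (G G' : 'M[int]_n) :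
    G *m G' = 1%:M ->
    (forall s, G *m map_mx at1 (T s) = cosetmx (Defs.gen s) *m G) ->
  specializes_to T t.
Proof.
move=> GG' TG; have G'G := mulmx1C GG'.
exists (fun x => G' *m cosetmx x *m G), (fun y => coset_sum (G *m y)).
split=> [|x y||x y].
- split=> [|x y|s]; first by rewrite r_free mulmx1.
    by rewrite cosetmxM -!mulmxA (mulmxA G) GG' mul1mx.
  by rewrite -mulmxA -TG mulmxA G'G mul1mx.
- by rewrite mulmxBr raddfB.
- exists (fun x => G' *m lamv x) => y; first by rewrite lamvK mulmxA G'G mul1mx.
  by rewrite mulmxA GG' mul1mx coset_sumK.
- by rewrite -!mulmxA (mulmxA G) GG' mul1mx coset_sum_act.
Qed.

(** Any integral realization of the natural lattice is conjugate over Z to the coset matrices. P and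
    Q are formally rectangular, since k = n is only deduced later from traces. *)
Lemma specializes_cosetE k (rho : B3 -> 'M[int]_k)
    (phi : 'cV[int]_k -> natlat t) :
    zmod_morphism phi -> bijective phi ->
    (forall w x, phi (rho w *m x) = natlat_act w (phi x)) ->
  exists (P : 'M[int]_(n, k)) (Q : 'M[int]_(k, n)),
    [/\ P *m Q = 1%:M, Q *m P = 1%:M & forall w, cosetmx w = P *m rho w *m Q].
Proof.
move=> phiB [phi' phiK phi'K] phi_act.
pose phiA := GRing.isZmodMorphism.Build _ _ _ phiB.
pose phi_ : {additive 'cV[int]_k -> natlat t} := HB.pack phi phiA.
pose f (x : 'cV[int]_k) := lamv (phi x); pose g (y : 'cV[int]_n) := phi' (coset_sum y).
have fK : cancel f g by move=> x; rewrite /f /g coset_sumK phiK.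
have gK : cancel g f by move=> x; rewrite /f /g phi'K lamvK.
have fB : zmod_morphism f.
  by move=> x y; rewrite /f phiB; apply/colP=> j; rewrite !mxE raddfB.
have gB : zmod_morphism g by move=> x y; apply: (can_inj fK); rewrite fB !gK.
have linear_mx a b (h : 'cV[int]_a -> 'cV[int]_b) : zmod_morphism h ->
    exists A : 'M[int]_(b, a), forall x, h x = A *m x.
  move=> hB; pose hA := GRing.isZmodMorphism.Build _ _ _ hB.
  pose h_ : {additive 'cV[int]_a -> 'cV[int]_b} := HB.pack h hA.
  exists (\matrix_(i, j) h (delta_mx j 0) i 0) => x.
  have -> : x = \sum_j delta_mx j 0 *~ x j 0.
    rewrite {1}(matrix_sum_delta x); apply: eq_bigr => j _.
    by rewrite big_ord1 -scaler_int intz.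
  rewrite -[h _]/(h_ _) raddf_sum mulmx_sumr; apply: eq_bigr => j _.
  rewrite raddfMz -scaler_int -[in RHS]scaler_int -scalemxAr -colE.
  by congr (_ *: _); apply/colP=> i; rewrite !mxE.
have [P PE] := linear_mx _ _ _ fB; have [Q QE] := linear_mx _ _ _ gB.
have mx1P a (A : 'M[int]_a) : (forall x : 'cV_a, A *m x = x) -> A = 1%:M.
  by move=> A1; apply: mulmx_col_inj => x; rewrite A1 mul1mx.
exists P, Q; split=> [||w].
- by apply: mx1P => x; rewrite -mulmxA -QE -PE gK.
- by apply: mx1P => x; rewrite -mulmxA -PE -QE fK.
apply: mulmx_col_inj => y.
by rewrite -!mulmxA -QE -PE -lamv_act /f phi_act /g phi'K.
Qed.

End Transversal.
End NaturalLattice.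

(** * Coset matrices computed from words *)

Definition lattice_check (d : sterm) (R : seq word) : bool :=
  let C := codes [seq r ++ h | r <- R, h <- gwords d.1] in
  all (fun c => c \in C) (codes (gwords 7)).

Definition moncoef (d : sterm) (u w : word) : int :=
  let c := cw w in
  foldr (fun h s => if cw (u ++ h) == c then sgw d.2 h + s else s) 0 (gwords d.1).

Definition monmx (d : sterm) (R : seq word) (w : word) : pmat :=
  mkmat (size R) (size R)
    (fun j i => [:: moncoef d (nth [::] R j) (w ++ nth [::] R i)]).

Definition repfun (R : seq word) (i : 'I_(size R)) : B3 := ev (nth [::] R i).

Lemma cosetmx_ev t d R w : denotes t d ->
  cosetmx t (@repfun R) (ev w) = pmx 1 (size R) (size R) (monmx d R w).
Proof.
move=> td; apply/matrixP=> j i; rewrite !mxE ent_mkmat //= mulr0 addr0 intz.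
rewrite (sum_grp _ td) /moncoef /repfun.
elim: (gwords _) => [|h L IH] /=; rewrite ?big_nil // big_cons IH.
by rewrite -!ev_cat ev_eq (tlin_ev _ td); case: eqP; rewrite ?mul1r ?mul0r ?add0r.
Qed.

Lemma lattice_cover t d R : denotes t d -> lattice_check d R ->
  forall x, exists i h, h \in tgrp t /\ x = (@repfun R i * h)%g.
Proof.
move=> td /allP RW x.
have [w /(map_f cw)/RW/mapP[_ /allpairsP[[r h] /= [rR hL ->]] wE ->]] := ev_W x.
have iR : (index r R < size R)%N by rewrite index_mem.
exists (Ordinal iR), (ev h); split.
  by case: td => k8 -> _ _ _; rewrite mem_grps // code_ev map_f.
by rewrite /repfun nth_index // -ev_cat; apply/eqP; rewrite ev_eq wE.
Qed.

(** * Bar invariant Hecke modules and W-graphs *)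

Lemma laurentE (x : laurent) :
  exists (p : {poly int}) n, x = (map_poly intr p).[v] * vV ^+ n.
Proof.
have [[p n] /= xE] := laurent_repr x; exists p, n.
suff xpE : x * v ^+ n = (map_poly intr p).[v].
  by rewrite -xpE -mulrA -exprMn v_vV expr1n mulr1.
apply: val_inj; rewrite rmorphM rmorphXn /= xE.
elim/poly_ind: p {xE} => [|p c IH]; first by rewrite tofrac0 map_poly0 horner0.
rewrite tofracD tofracM IH rmorphD rmorphM /= map_polyX map_polyC !hornerE /=.
congr (_ + _).
rewrite -[c in LHS]intz (rmorph_int (@polyC int)) (rmorph_int (@tofrac {poly int})).
by rewrite -[RHS]/(\val (c%:~R : laurent)) rmorph_int.
Qed.

Lemma barM x y : bar (x * y) = bar x * bar y.
Proof. exact: rmorphM bar x y. Qed.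

Lemma barX x n : bar (x ^+ n) = bar x ^+ n.
Proof. exact: rmorphXn bar n x. Qed.

Lemma bar_vV : bar vV = v.
Proof.
have : bar v * bar vV = 1 by rewrite -rmorphM v_vV rmorph1.
rewrite bar_v => /(congr1 (fun x => v * x)).
by rewrite mulrA v_vV mul1r mulr1.
Qed.

Lemma barK : involutive bar.
Proof.
have barP (p : {poly int}) x : bar (map_poly intr p).[x] = (map_poly intr p).[bar x].
  rewrite -horner_map -map_poly_comp; congr (_.[_]).
  by apply: eq_map_poly => z /=; rewrite rmorph_int.
move=> x; have [p [n ->]] := laurentE x.
have -> : bar ((map_poly intr p).[v] * vV ^+ n) = (map_poly intr p).[vV] * v ^+ n.
  by rewrite barM barX barP bar_v bar_vV.
by rewrite barM barX barP bar_v bar_vV.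
Qed.

Lemma std_vec_basis n : is_basis (@std_vec n).
Proof.
move=> x; exists [ffun i => x i 0]; split.
  rewrite {1}(matrix_sum_delta x); apply: eq_bigr => i _.
  by rewrite big_ord1 ffunE.
move=> c ->; apply/ffunP=> i; rewrite ffunE summxE (bigD1 i) //= big1 => [|j ji].
  by rewrite !mxE !eqxx mulr1 addr0.
by rewrite !mxE eq_sym (negPf ji) mulr0.
Qed.

(* A bar invariant basis is the canonical basis attached to itself, as standard
   basis, and to the trivial order. *)
Lemma canonical_std n (T : hecke_action n) :
  (forall s, map_mx bar (T s) = T s - a_%:M) -> has_canonical_basis T (@std_vec n).
Proof.
move=> barT; exists (map_mx bar), (fun _ _ => false), (@std_vec n); split.
- split=> [x y|c x|x|h x].
  + exact: map_mxD.
  + exact: map_mxZ.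
  + by apply/colP=> i; rewrite !mxE barK.
  rewrite map_mxM; congr (_ *m _).
  elim: h => [c|s|h1 IH1 h2 IH2|h1 IH1 h2 IH2] /=.
  + exact: map_scalar_mx.
  + by rewrite barT raddfN.
  + by rewrite map_mxD IH1 IH2.
  + by rewrite map_mxM IH1 IH2.
- by split.
- exact: std_vec_basis.
- move=> x; exists (fun=> 0); rewrite big_pred0 // addr0.
  by rewrite /std_vec map_delta_mx.
split=> [|x|x]; first exact: std_vec_basis.
  by rewrite /std_vec map_delta_mx.
exists (fun=> 0); last by rewrite big_pred0 // addr0.
by move=> y; exists 0; rewrite rmorph0 horner0 mulr0.
Qed.

(** The constant a = v - v^-1 multiplied by v^(k+1). *)
Definition pdiff k : seq int := padd (pmon k.+2 1) (popp (pmon k 1)).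

Lemma peval_diff k : peval v (pdiff k) = a_ * v ^+ k.+1.
Proof.
rewrite peval_add peval_opp !peval_mon !mul1r /a_ mulrBl -exprS.
by rewrite [in vV * _]exprS mulrA vV_v mul1r.
Qed.

Lemma vV_vX k : vV ^+ k * v ^+ k = 1.
Proof. by rewrite -exprMn vV_v expr1n. Qed.

Lemma at1M x y : at1 (x * y) = at1 x * at1 y.
Proof. exact: (rmorphM at1). Qed.

Lemma at1_vV : at1 vV = 1.
Proof. by rewrite -[LHS]mul1r -{1}at1_v -at1M v_vV; apply: (rmorph1 at1). Qed.

Lemma at1_peval k p : at1 (vV ^+ k * peval v p) = peval 1 p.
Proof.
have at1X : at1 (vV ^+ k) = at1 vV ^+ k by exact: (rmorphXn at1).
have at1p : at1 (peval v p) = peval (at1 v) p by exact: (peval_rmorph at1).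
by rewrite at1M at1X at1p at1_v at1_vV expr1n mul1r.
Qed.

Definition prev N (p : seq int) : seq int := rev (p ++ nseq (N.+1 - size p) 0).

Section HeckeMatrices.
Variables (k n : nat) (A : seq pmat).

(* The matrix of T_s is v^-(k+1) A_s. *)
Definition heckemx : hecke_action n :=
  fun s => vV ^+ k.+1 *: pmx v n n (nth [::] A s).

Local Notation mm := (pmulmx n n n).

(** For B = v^(k+1) T_s the quadratic relation reads B^2 = v^(2k+2) + a v^(k+1) B; the other
    relations are homogeneous and keep their form. *)
Definition hecke_check : bool :=
  let A0 := nth [::] A 0 in let A1 := nth [::] A 1 in let A2 := nth [::] A 2 in
  let q B := peqmx n n (mm B B)
    (paddmx n n (pscalar n (pmon (k.+1).*2 1)) (pscalemx n n (pdiff k) B)) in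
  let A01 := mm A0 A1 in let A10 := mm A1 A0 in
  [&& q A0, q A1, q A2, peqmx n n (mm A01 A01) (mm A10 A10),
      peqmx n n (mm (mm A1 A2) A1) (mm (mm A2 A1) A2)
    & peqmx n n (mm A0 A2) (mm A2 A0)].

Lemma hecke_checkP : hecke_check -> hecke_module heckemx.
Proof.
case/andP=> q0 /and5P[q1 q2 b01 b12 c02].
pose X s := pmx v n n (nth [::] A s).
have hE (s : 'I_3) : heckemx s = vV ^+ k.+1 *: X s by [].
split.
- have quad B : peqmx n n (mm B B)
      (paddmx n n (pscalar n (pmon (k.+1).*2 1)) (pscalemx n n (pdiff k) B)) ->
    vV ^+ k.+1 *: pmx v n n B *m (vV ^+ k.+1 *: pmx v n n B)
    = 1%:M + a_ *: (vV ^+ k.+1 *: pmx v n n B).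
    move=> /(pmx_eq v); rewrite pmx_mul pmx_add pmx_scalar pmx_scale => BB.
    rewrite -scalemxAl -scalemxAr BB [LHS]scalerA -exprD addnn scalerDr.
    rewrite scale_scalar_mx peval_mon mul1r vV_vX; congr (_ + _).
    rewrite !scalerA peval_diff -addnn exprD; congr (_ *: _).
    by rewrite mulrACA [vV ^+ _ * v ^+ _]vV_vX mulr1 mulrC.
  move=> s; suff /(_ s) : forall s : 'I_3, peqmx n n (mm (nth [::] A s) (nth [::] A s))
      (paddmx n n (pscalar n (pmon (k.+1).*2 1)) (pscalemx n n (pdiff k) (nth [::] A s))).
    exact: quad.
  exact: ord3P.
- rewrite !hE -!(scalemxAl, scalemxAr) !scalerA; congr (_ *: _).
  by move: b01 => /(pmx_eq v); rewrite !pmx_mul !mulmxA.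
- rewrite !hE -!(scalemxAl, scalemxAr) !scalerA; congr (_ *: _).
  by move: b12 => /(pmx_eq v); rewrite !pmx_mul.
- rewrite !hE -!(scalemxAl, scalemxAr) !scalerA; congr (_ *: _).
  by move: c02 => /(pmx_eq v); rewrite !pmx_mul.
Qed.

(** The condition that bar T_s = T_s - a, multiplied by v^(k+1): the left side becomes v^N B(v^-1)
    with N = 2k + 2, which [prev N] computes thanks to the bound on the degrees. *)
Definition bar_check : bool :=
  let N := (k.+1).*2 in
  all (fun B =>
    all (fun i => all (fun j => size (ent B i j) <= N.+1)%N (iota 0 n)) (iota 0 n)
    && peqmx n n (mkmat n n (fun i j => prev N (ent B i j)))
         (paddmx n n B (pscalar n (popp (pdiff k)))))
    [:: nth [::] A 0; nth [::] A 1; nth [::] A 2].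

Lemma bar_checkP : bar_check -> has_canonical_basis heckemx (@std_vec n).
Proof.
move=> /allP barA; apply: canonical_std => s.
have /barA /andP[/allP Asize /(pmx_eq v)] :
    nth [::] A s \in [:: nth [::] A 0; nth [::] A 1; nth [::] A 2].
  by move: s; apply: ord3P; rewrite !inE eqxx ?orbT.
rewrite pmx_add pmx_scalar peval_opp peval_diff /heckemx.
move: (nth _ A s) Asize => B Asize /(congr1 (fun M => vV ^+ k.+1 *: M)).
rewrite scalerDr scale_scalar_mx mulrN mulrCA vV_vX mulr1 raddfN /= => <-.
apply/matrixP=> i j; rewrite !mxE ent_mkmat // barM barX bar_vV.
rewrite (peval_rmorph bar) /= bar_v.
have sz : (size (ent B i j) <= ((k.+1).*2).+1)%N.
  have iota_ord (l : 'I_n) : (l : nat) \in iota 0 n by rewrite mem_iota /=.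
  exact: (allP (Asize i (iota_ord i)) j (iota_ord j)).
rewrite -(peval_inv (n := (k.+1).*2) v_vV); last first.
  by rewrite size_cat size_nseq subnKC.
by rewrite peval_pad -addnn exprD !mulrA vV_vX mul1r.
Qed.

Definition special_check (d : sterm) (R : seq word) (G G' : pmat) : bool :=
  let m := size R in
  [&& n == m, lattice_check d R, peqmx m m (monmx d R [::]) (pscalar m [:: 1]),
      peqmx m m (pmulmx m m m G G') (pscalar m [:: 1])
    & all (fun s => peqmx m m (pmulmx m m m G (pmx1 m m (nth [::] A s)))
                       (pmulmx m m m (monmx d R [:: s]) G)) (iota 0 3)].

Lemma special_checkP t d R G G' :
  denotes t d -> special_check d R G G' -> specializes_to heckemx t.
Proof.
rewrite /heckemx => td; case/and5P=> /eqP-> lat Id GG' /allP TG.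
have free : cosetmx t (@repfun R) 1%g = 1%:M.
  rewrite -[1%g]/(ev [::]) (cosetmx_ev _ _ td) (pmx_eq _ Id) pmx_scalar /=.
  by rewrite mulr0 addr0.
have {}GG' : pmx (1 : int) (size R) (size R) G *m pmx 1 (size R) (size R) G' = 1%:M.
  by rewrite -pmx_mul (pmx_eq _ GG') pmx_scalar /= mulr0 addr0.
apply: (specializes_coset free (lattice_cover td lat) GG') => s.
have /TG/(pmx_eq (1 : int)) : (s : nat) \in iota 0 3 by rewrite mem_iota /=.
rewrite !pmx_mul pmx1E -(cosetmx_ev _ _ td) /= mulg1 => <-.
by congr (_ *m _); apply/matrixP=> i j; rewrite !mxE at1_peval.
Qed.

End HeckeMatrices.

(** * W-graphs given by adjacency lists *)

(* Adjacency lists of the edges, all of weight c. *)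
Record wdata := WData { wd_tau : seq (seq nat); wd_adj : seq (seq nat); wd_c : int }.

Definition wd_wt (D : wdata) x y : int :=
  if y \in nth [::] (wd_adj D) x then wd_c D else 0.

(** Column x is v T_s C_x: the factor v turns the coefficients -v^-1, wt and v into -1, v wt and
    v^2. *)
Definition wd_mat (D : wdata) n s : pmat :=
  mkmat n n (fun y x =>
    if s \in nth [::] (wd_tau D) x then
      if y == x then [:: -1] else
      if s \in nth [::] (wd_tau D) y then [::] else [:: 0; wd_wt D x y]
    else if y == x then [:: 0; 0; 1] else [::]).

Definition wd_mats D n : seq pmat := [seq wd_mat D n s | s <- iota 0 3].

Definition wd_graph (D : wdata) n : wgraph n :=
  WGraph (fun x => [set s : 'I_3 | (s : nat) \in nth [::] (wd_tau D) x])
         (fun x y => wd_wt D x y).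

Lemma wd_graphP D n : hecke_check 0 n (wd_mats D n) ->
  wgraph_module (wd_graph D n) (heckemx 0 n (wd_mats D n)).
Proof.
move=> /hecke_checkP hT; split=> // s x; rewrite /std_vec -colE.
have inE_tau (y : 'I_n) :
    (s \in wg_tau (wd_graph D n) y) = ((s : nat) \in nth [::] (wd_tau D) y).
  by rewrite inE.
have sD : nth [::] (wd_mats D n) s = wd_mat D n s by move: s {inE_tau}; apply: ord3P.
apply/colP=> y; rewrite inE_tau !mxE sD ent_mkmat // expr1 val_eqE.
case: ifP => sx; last first.
  rewrite !mxE !eqxx andbT; case: (y == x); rewrite /= ?mulr0 //.
  by rewrite !(add0r, addr0, mulr0, mulr1) mulrA vV_v mul1r.
rewrite !mxE summxE !eqxx andbT.
have sumE : \sum_(z | s \notin wg_tau (wd_graph D n) z)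
      ((wg_wt (wd_graph D n) x z)%:~R *: delta_mx z 0 : 'cV[laurent]_n) y 0
    = if (s : nat) \in nth [::] (wd_tau D) y then 0 else (wd_wt D x y)%:~R.
  rewrite big_mkcond (bigD1 y) //= big1 => [|z zy].
    by rewrite inE_tau !mxE !eqxx /= mulr1 addr0; case: (_ \in _).
  by case: ifP => // _; rewrite !mxE eq_sym (negPf zy) mulr0.
rewrite sumE; have [->|_] := eqVneq y x.
  by rewrite sx /= !(mulr0, addr0, mulr1) mulrN1.
by case: ifP => _; rewrite /= !(mulr0, addr0, add0r) // mulrA vV_v mul1r.
Qed.

Definition wgraph_check (d : sterm) R D G G' : bool :=
  let n := size R in let A := wd_mats D n in
  [&& hecke_check 0 n A, bar_check 0 n A & special_check n A d R G G'].

Lemma wgraph_checkP t d R D G G' :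
  denotes t d -> wgraph_check d R D G G' -> canonical_wgraph_lattice t.
Proof.
move=> td /and3P[hA bA sA].
exists (size R), (wd_graph D (size R)), (heckemx 0 _ (wd_mats D (size R))); split.
- exact: wd_graphP.
- exact: bar_checkP.
- exact: special_checkP sA.
Qed.

Lemma canonical_wgraph_deformation t :
  canonical_wgraph_lattice t -> canonical_deformation t.
Proof.
by case=> n [G [T [[hT _] cT sT]]]; exists n, T, (@std_vec n).
Qed.

Definition deformation_check (d : sterm) k R A G G' : bool :=
  let n := size R in
  [&& hecke_check k n A, bar_check k n A & special_check n A d R G G'].

Lemma deformation_checkP t d k R A G G' :
  denotes t d -> deformation_check d k R A G G' -> canonical_deformation t.
Proof.
move=> td /and3P[hA bA sA].
exists (size R), (heckemx k _ A), (@std_vec _); split.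
- exact: hecke_checkP.
- exact: special_checkP sA.
- exact: bar_checkP.
Qed.

(** * The rank obstruction *)

Lemma mxrank_sum_le (F : fieldType) m n (I : finType) (A : {pred I})
    (M : I -> 'M[F]_(m, n)) :
  (forall i, \rank (M i) <= 1)%N -> (\rank (\sum_(i in A) M i)%R <= #|A|)%N.
Proof.
move=> M1; rewrite -sum1_card; elim/big_rec2: _ => [|i r N _ rN].
  by rewrite mxrank0.
exact: leq_trans (mxrank_add _ _) (leq_add (M1 i) rN).
Qed.

(** A matrix supported on the rows in A and the columns in B is a sum of matrices of rank at most
    one, one for each of these lines. *)
Lemma rank_cover (F : fieldType) n (M : 'M[F]_n) (A B : {set 'I_n}) :
    (forall y x, y \notin A -> x \notin B -> M y x = 0) ->
  (\rank M <= #|A| + #|B|)%N.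
Proof.
(* N clears the rows in A, so that entries where a row of A meets a column of B are counted once. *)
move=> M0; pose N : 'M[F]_n := \matrix_(y, x) if y \in A then 0 else M y x.
have -> : M = \sum_(y in A) delta_mx y 0 *m row y M
            + \sum_(x in B) col x N *m (delta_mx 0 x : 'rV_n).
  apply/matrixP=> y x; rewrite !mxE !summxE.
  have delta1 (z : 'I_n) : (delta_mx z 0 *m row z M) y x = (y == z)%:R * M z x.
    by rewrite mxE big_ord1 !mxE eqxx andbT.
  have delta2 (z : 'I_n) : (col z N *m (delta_mx 0 z : 'rV_n)) y x = N y z * (x == z)%:R.
    by rewrite mxE big_ord1 !mxE eqxx.
  rewrite (eq_bigr _ (fun z _ => delta1 z)) (eq_bigr _ (fun z _ => delta2 z)).
  rewrite [X in X + _]big_mkcond [X in _ + X]big_mkcond.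
  rewrite (bigD1 y) //= [X in _ + X](bigD1 x) //= !eqxx mul1r mulr1 mxE.
  rewrite !big1 ?addr0 => [|z zx|z zy]; last first.
  - by rewrite eq_sym (negPf zy) mul0r if_same.
  - by rewrite eq_sym (negPf zx) mulr0 if_same.
  have [yA|yA] := boolP (y \in A); first by rewrite if_same addr0.
  by have [xB|xB] := boolP (x \in B); rewrite add0r // M0.
have rank1 m p (u : 'M[F]_(m, 1)) (w : 'M_(1, p)) : (\rank (u *m w) <= 1)%N.
  exact: leq_trans (mxrankM_maxr _ _) (rank_leq_row _).
apply: leq_trans (mxrank_add _ _) (leq_add _ _); apply: mxrank_sum_le => i;
exact: rank1.
Qed.

Section WGraphObstruction.
Variables (n : nat) (G : wgraph n) (T : hecke_action n) (rho : B3 -> 'M[int]_n).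
Hypotheses (GT : wgraph_module G T) (Trho : specialization T rho).

Local Notation tau := (wg_tau G).
Local Notation wt := (wg_wt G).

Lemma wgraph_rhoE (s : 'I_3) y x : rho (Defs.gen s) y x =
  if s \in tau x then (if s \in tau y then 0 else wt x y) - (y == x)%:R
  else (y == x)%:R.
Proof.
case: Trho => _ _ ->; rewrite mxE.
have -> : T s y x = (T s *m std_vec x) y 0 by rewrite /std_vec -colE mxE.
case: GT => _ ->.
have at1D a b : at1 (a + b) = at1 a + at1 b by exact: (rmorphD at1).
have at1N a : at1 (- a) = - at1 a by exact: (rmorphN at1).
have at1z (a : int) : at1 a%:~R = a by rewrite (rmorph_int at1 a) intz.
have at1b (b : bool) : at1 b%:R = b%:R.
  by case: b; [apply: (rmorph1 at1) | apply: (rmorph0 at1)].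
case: ifP => [/negPf->|/negbFE sx].
  by rewrite !mxE eqxx andbT at1M at1_v mul1r at1b.
rewrite sx !mxE summxE eqxx andbT at1D at1M at1N at1_vV at1b mulN1r addrC.
congr (_ - _); rewrite big_mkcond (bigD1 y) //= big1 ?addr0 => [|z zy].
  case: (s \in tau y) => /=; first exact: (rmorph0 at1).
  by rewrite !mxE !eqxx /= mulr1 at1z.
by case: ifP => // _; rewrite !mxE eq_sym (negPf zy) mulr0.
Qed.

Local Notation R0 := (rho (Defs.gen i0)).
Local Notation R2 := (rho (Defs.gen i2)).

Lemma rho_commute : R0 *m R2 = R2 *m R0.
Proof.
case: Trho => _ rhoM _; rewrite -!rhoM; congr rho.
rewrite -[Defs.gen i0]/(genn 0) -[Defs.gen i2]/(genn 2) !genE -!ev_cat.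
by apply/eqP; rewrite ev_eq.
Qed.

(** Column x of [R2] is that of the identity, and row y is minus that of the identity. Hence the
    entry (y, x) of s0 s2 = s2 s0 equates wt(x, y) with its negative. *)
Lemma wt_commute x y : i0 \in tau x -> i2 \notin tau x ->
  i2 \in tau y -> i0 \notin tau y -> wt x y = 0.
Proof.
move=> x0 x2 y2 y0; have yx : y != x by apply: contraNneq y0 => ->.
have R0yx : R0 y x = wt x y by rewrite wgraph_rhoE x0 (negPf y0) (negPf yx) subr0.
have : R0 y x = - R0 y x; last by rewrite R0yx; lia.
have /matrixP/(_ y x) := rho_commute; rewrite !mxE.
rewrite (bigD1 x) //= big1 => [|z zx]; last first.
  by rewrite [R2 _ _]wgraph_rhoE (negPf x2) (negPf zx) mulr0.
rewrite (bigD1 y) //= [X in _ = _ + X]big1 => [|z zy]; last first.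
  rewrite [R2 _ _]wgraph_rhoE y2 eq_sym (negPf zy) subr0.
  by case: (_ \in _); rewrite mul0r.
by rewrite !wgraph_rhoE (negPf x2) y2 !eqxx !addr0 mulr1 sub0r mulN1r.
Qed.

(** A nonzero product of the entries (x, y) of s0 and (y, x) of s2 with y != x would need s0 in
    tau(y) only and s2 in tau(x) only, an edge excluded by [wt_commute]. The diagonal entries are
    signs. *)
Lemma wgraph_trace :
  \tr (rho (Defs.gen i0 * Defs.gen i2)%g)
  = \sum_x (if (i0 \in tau x) == (i2 \in tau x) then 1 else -1).
Proof.
case: Trho => _ rhoM _; rewrite rhoM; apply: eq_bigr => x _; rewrite mxE.
have R0xx : R0 x x = if i0 \in tau x then -1 else 1.
  by rewrite wgraph_rhoE eqxx; case: (i0 \in _).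
rewrite (bigD1 x) //= big1 => [|y yx].
  by rewrite R0xx wgraph_rhoE eqxx; case: (i0 \in _); case: (i2 \in _).
rewrite [R2 _ _]wgraph_rhoE (negPf yx) subr0; case: ifP => [x2|]; last by rewrite mulr0.
have [|y2] := boolP (i2 \in tau y); first by rewrite mulr0.
rewrite wgraph_rhoE eq_sym (negPf yx) subr0.
have [y0|] := boolP (i0 \in tau y); last by rewrite mul0r.
have [|x0] := boolP (i0 \in tau x); first by rewrite mul0r.
by rewrite (wt_commute y0 y2 x2 x0) mul0r.
Qed.

(* Modulo 2, the nonzero entries of s0 - 1 lie in the rows y with s0, s2 not in
   tau(y) or in the columns x with s0, s2 in tau(x); the trace of s0 s2 counts
   these lines. *)
Lemma wgraph_rank_bound :
  ((\rank (map_mx intr (R0 - 1%:M)%R : 'M['F_2]_n)).*2%:Z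
   <= n%:Z + \tr (rho (Defs.gen i0 * Defs.gen i2)%g))%R.
Proof.
pose A := [set x | (i0 \notin tau x) && (i2 \notin tau x)].
pose B := [set x | (i0 \in tau x) && (i2 \in tau x)].
have le_rank : (\rank (map_mx intr (R0 - 1%:M)%R : 'M['F_2]_n) <= #|A| + #|B|)%N.
  apply: rank_cover => y x; rewrite !inE !negb_and !negbK => yA xB; rewrite !mxE.
  rewrite wgraph_rhoE; have [x0|x0] := boolP (i0 \in tau x); last by rewrite subrr.
  have two0 : 2%:R = 0 :> 'F_2 by apply: val_inj.
  (* If s0 lies in both labels, the entry of s0 - 1 is 0 or -2, hence even. *)
  have [y0|y0] := boolP (i0 \in tau y).
    by rewrite sub0r -opprD -mulr2n rmorphN /= rmorphMn /= -mulr_natr two0 mulr0 oppr0.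
  rewrite (negPf y0) in yA; rewrite x0 in xB.
  have -> : (y == x) = false by apply/negbTE; apply: contraNneq y0 => ->.
  by rewrite (wt_commute x0 xB yA y0) !subr0.
have -> : n%:Z = \sum_(x < n) 1 by rewrite sumr_const card_ord -mulr_natr mul1r natz.
rewrite wgraph_trace -big_split /=.
have -> : \sum_(x < n) (1 + (if (i0 \in tau x) == (i2 \in tau x) then 1 else -1))
  = (#|A| + #|B|).*2%:Z.
  have cardE (D : {set 'I_n}) : #|D|%:Z = \sum_x (x \in D)%:Z.
    rewrite -sum1_card big_mkcond (big_morph Posz PoszD (erefl 0)).
    by apply: eq_bigr => x _; case: (x \in D).
  rewrite -mul2n PoszM PoszD !cardE -big_split mulr_sumr /=; apply: eq_bigr => x _.
  by rewrite !inE; case: (i0 \in _); case: (i2 \in _).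
by rewrite lez_nat leq_double.
Qed.

End WGraphObstruction.

Definition ptrace m (A : pmat) : int :=
  foldr (fun i s => peval 1 (ent A i i) + s) 0 (iota 0 m).

Lemma ptraceE m A : ptrace m A = \tr (pmx (1 : int) m m A).
Proof.
rewrite /ptrace /mxtrace (eq_bigr (fun i : 'I_m => peval 1 (ent A i i))); last first.
  by move=> i _; rewrite mxE.
rewrite -(big_mkord xpredT (fun i => peval (1 : int) (ent A i i))) /index_iota subn0.
by elim: (iota 0 m) => [|i l IH]; rewrite ?big_nil // big_cons /= IH.
Qed.

(* The r x r matrix U (s0 - 1) V is the identity. *)
Definition obstruction_check (d : sterm) (R : seq word) r (U V : pmat) : bool :=
  let m := size R in
  [&& lattice_check d R, peqmx m m (monmx d R [::]) (pscalar m [:: 1]),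
      peqmx r r (pmulmx r m r (pmulmx r m m U
        (paddmx m m (monmx d R [:: 0%N]) (pscalar m [:: -1]))) V) (pscalar r [:: 1])
    & (m%:Z + ptrace m (monmx d R [:: 0%N; 2%N]) < r.*2%:Z)%R].

(** The integral identity U (s0 - 1) V = 1 survives reduction modulo 2 and conjugation over Z, so s0
    - 1 has rank at least r modulo 2, against the bound for W-graphs. *)
Lemma obstruction_checkP t d R r U V :
  denotes t d -> obstruction_check d R r U V -> ~ wgraph_lattice t.
Proof.
move=> td /and4P[lat Id UV trlt] [n [G [T [GT [rho [phi [Trho phiB phi_bij phi_act]]]]]]].
have free : cosetmx t (@repfun R) 1%g = 1%:M.
  rewrite -[1%g]/(ev [::]) (cosetmx_ev _ _ td) (pmx_eq _ Id) pmx_scalar /=.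
  by rewrite mulr0 addr0.
have [P [Q [PQ QP cosetE]]] :=
  specializes_cosetE free (lattice_cover td lat) phiB phi_bij phi_act.
have trE w : \tr (rho w) = \tr (cosetmx t (@repfun R) w).
  by rewrite cosetE mxtrace_mulC mulmxA QP mul1mx.
(* The traces of the identity give the equality of the ranks. *)
have nm : n%:Z = (size R)%:Z.
  by have := trE 1%g; rewrite free; case: Trho => -> _ _; rewrite !mxtrace1 !natz.
have := wgraph_rank_bound GT Trho; apply/negP; rewrite -ltNge nm trE.
have -> : (Defs.gen i0 * Defs.gen i2)%g = ev [:: 0; 2]%N by rewrite /= mulg1.
rewrite (cosetmx_ev _ _ td) -ptraceE; apply: lt_le_trans trlt _.
rewrite lez_nat leq_double.
have {}UV : pmx (1 : int) r (size R) U *m (P *m (rho (Defs.gen i0) - 1%:M) *m Q)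
    *m pmx 1 (size R) r V = 1%:M.
  rewrite mulmxBr mulmx1 mulmxBl PQ -cosetE.
  have -> : Defs.gen i0 = ev [:: 0%N] by rewrite /= mulg1.
  have /(pmx_eq (1 : int)) := UV; rewrite !pmx_mul pmx_add !pmx_scalar /=.
  by rewrite !(mulr0, addr0) -(cosetmx_ev _ _ td) intz raddfN.
have := congr1 (map_mx (intr : int -> 'F_2)) UV; rewrite map_mx1 => UV2.
rewrite -[r in leqLHS](mxrank1 'F_2) -UV2 !map_mxM.
apply: leq_trans (mxrankM_maxl _ _) _; apply: leq_trans (mxrankM_maxr _ _) _.
by apply: leq_trans (mxrankM_maxl _ _) _; apply: mxrankM_maxr.
Qed.

(** * Characters of the terms *)

Definition linsgn (a : linchar) (b : bool * bool) : Prop :=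
  [/\ a s0 = (-1) ^+ b.1, a s1 = (-1) ^+ b.2 & a s2 = (-1) ^+ b.2].

Lemma linsgn_triv : linsgn chi_triv (false, false).
Proof. by []. Qed.

Lemma linsgn_delta : linsgn delta (false, true).
Proof.
by split; rewrite /delta /= /delta_val /= ?odd_perm1 ?odd_tperm.
Qed.

Lemma linsgn_mul a b x y :
  linsgn a x -> linsgn b y -> linsgn (linmul a b) (x.1 (+) y.1, x.2 (+) y.2).
Proof.
case=> a0 a1 a2 [b0 b1 b2].
by split; rewrite /= signr_addb ?a0 ?a1 ?a2 ?b0 ?b1 ?b2.
Qed.

Lemma linsgn_omega : linsgn omega (true, true).
Proof. by have [] := omega_gens; split. Qed.

Lemma linsgn_eps : linsgn eps (true, false).
Proof.
have [o0 o1 o2] := linsgn_omega; have [d0 d1 d2] := linsgn_delta.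
have epsE x : eps x = omega x * delta x.
  by rewrite /omega /= -mulrA -[delta_val x * _]signr_addb addbb mulr1.
by split; rewrite epsE ?o0 ?o1 ?o2 ?d0 ?d1 ?d2.
Qed.

Lemma denotes_Term k G a b : (k < 8)%N -> G = nth 1%G grps k -> linsgn a b ->
  denotes (Term G a) (k, b).
Proof. by move=> k8 GE [a0 a1 a2]; split. Qed.

Definition stwist (d : sterm) : sterm := (d.1, (~~ d.2.1, ~~ d.2.2)).

Lemma denotes_omega t d : denotes t d -> denotes (term_twist omega t) (stwist d).
Proof.
case: t => G a [/= k8 GE a0 a1 a2]; apply: denotes_Term => //.
exact: (@linsgn_mul omega a (true, true) d.2 linsgn_omega).
Qed.

(* 48 times the value of the induced character. *)
Definition char48 (d : sterm) (w : word) : int :=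
  let H := gwords d.1 in
  foldr (fun y s =>
    let c := cw (w ++ y) in
    foldr (fun h s' => (if cw (y ++ h) == c then sgw d.2 h else 0) + s') 0 H + s)
    0 (gwords 7)
  * (48 %/ size H)%:Z.

Lemma card_tgrp t d : denotes t d -> #|tgrp t| = size (gwords d.1).
Proof.
move=> td; rewrite -sum1_card (sum_grp (fun=> 1%N) td).
by rewrite sum1_size.
Qed.

Lemma lin_cfE (H : {group B3}) (a : linchar) x :
  lin_cf H a x = (a x)%:~R *+ (x \in H).
Proof. by rewrite cfunE. Qed.

Lemma char48E t d w : denotes t d ->
  48%:R * term_char t (ev w) = (char48 d w)%:~R.
Proof.
move=> td; rewrite /term_char cfIndE ?subsetT //.
have W7 : denotes (trm_lin chi_triv) (7%N, (false, false)).
  exact: denotes_Term linsgn_triv.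
have [k8 _ _ _ _] := td.
have /all_nthP-/(_ [::] d.1 k8)/eqP dvd48 :
    all (fun L => (size L * (48 %/ size L) == 48)%N) grp_words by vm_compute.
have foldE (I : Type) (l : seq I) (F : I -> int) :
    foldr (fun y s => F y + s) 0 l = \sum_(y <- l) F y.
  by elim: l => [|y l IH]; rewrite ?big_nil // big_cons -IH.
rewrite (sum_grp _ W7) (card_tgrp td) /char48 foldE rmorphM /= mulrA mulrC rmorph_sum.
congr (_ * _).
  apply: eq_bigr => y _; rewrite foldE lin_cfE rmorph_sum /=.
  have [Hx|Hx] := boolP (_ \in _).
    have <- : \sum_(h in tgrp t) ((ev y * h == ev w * ev y)%g%:Z * tlin t h)%:~R
        = (tlin t (ev w ^ ev y)%g)%:~R *+ true :> algC.
      rewrite (bigD1 (ev w ^ ev y)%g) //= -conjgC eqxx mul1r big1 ?addr0 // => h.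
      move=> /andP[_ hN]; rewrite (_ : _ == _ = false) ?mul0r //.
      by apply: contraNF hN => /eqP/esym E; rewrite conjgE E mulKg.
    rewrite (sum_grp _ td); apply: eq_bigr => h _.
    by rewrite -!ev_cat ev_eq (tlin_ev _ td); case: eqP; rewrite ?mul1r ?mul0r.
  rewrite mulr0n big_seq big1 // => h hL; case: eqP => // E; case/negP: Hx.
  have -> : (ev w ^ ev y)%g = ev h.
    rewrite conjgE; apply: (mulgI (ev y)); rewrite mulKVg -!ev_cat.
    by apply/eqP; rewrite ev_eq E.
  by case: td => _ -> _ _ _; rewrite mem_grps // code_ev map_f.
rewrite -/(gwords d.1) in dvd48.
have H0 : (size (gwords d.1))%:R != 0 :> algC.
  by rewrite pnatr_eq0; apply: contraPneq dvd48 => ->.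
by apply: (mulIf H0); rewrite mulfVK // -pmulrn -natrM mulnC dvd48.
Qed.

(** The values at 1, s0 and s1 already tell the twenty-four sets of characters apart. *)
Definition charvec (d : sterm) : seq int :=
  [seq char48 d w | w <- [:: [::]; [:: 0%N]; [:: 1%N]]].
Definition cfvec (phi : 'CF([set: B3])) : seq algC :=
  [seq 48%:R * phi (ev w) | w <- [:: [::]; [:: 0%N]; [:: 1%N]]].

Lemma cfvecE t d : denotes t d -> cfvec (term_char t) = [seq z%:~R | z <- charvec d].
Proof. by move=> td; rewrite -map_comp; apply: eq_map => w /=; rewrite (char48E w td). Qed.

Lemma charvec_sub (M N : model) (ds es : seq sterm) :
    List.Forall2 denotes M ds -> List.Forall2 denotes N es ->
    {subset model_chars M <= model_chars N} ->
  {subset map charvec ds <= map charvec es}.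
Proof.
have vecs (M' : model) ds' : List.Forall2 denotes M' ds' ->
    map cfvec (model_chars M') = map (map intr) (map charvec ds').
  by elim=> [|t d M1 ds1 td _ IH] //=; rewrite IH (cfvecE td).
move=> /vecs MD /vecs NE MN z zD.
have : map intr z \in map cfvec (model_chars M) by rewrite MD map_f.
move=> /mapP[c /MN cN zE].
have : map intr z \in map cfvec (model_chars N) by rewrite zE map_f.
by rewrite NE => /mapP[z' z'E /(inj_map (intr_inj (R := algC)))->].
Qed.

(** * The terms of the models *)

Definition unitwd (tau adj : seq (seq nat)) : wdata := WData tau adj 1.

Definition grp_reps : seq (seq word) :=
  [:: [:: [::]; [:: 2]; [:: 1; 2]];
      [:: [::]; [:: 2]; [:: 1; 2]; [:: 0; 1; 2]; [:: 1; 0; 1; 2];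
          [:: 2; 1; 0; 1; 2]];
      [:: [::]; [:: 1]; [:: 0; 1]; [:: 2; 1]; [:: 1; 0; 1]; [:: 2; 0; 1];
          [:: 2; 1; 0; 1]; [:: 1; 2; 0; 1]; [:: 1; 2; 1; 0; 1];
          [:: 0; 1; 2; 0; 1]; [:: 0; 1; 2; 1; 0; 1]; [:: 1; 0; 1; 2; 1; 0; 1]];
      [:: [::]; [:: 0]; [:: 1; 0]; [:: 0; 1; 0]];
      [:: [::]; [:: 0]; [:: 1; 0]; [:: 0; 1; 0]; [:: 2; 1; 0];
          [:: 2; 0; 1; 0]; [:: 1; 2; 0; 1; 0]; [:: 0; 1; 2; 0; 1; 0]];
      [:: [::]; [:: 0]; [:: 2]; [:: 2; 0]; [:: 1; 2]; [:: 1; 2; 0];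
          [:: 0; 1; 2]; [:: 0; 1; 2; 0]; [:: 1; 0; 1; 2]; [:: 1; 0; 1; 2; 0];
          [:: 2; 1; 0; 1; 2]; [:: 2; 1; 0; 1; 2; 0]];
      [:: [::]; [:: 0]];
      [:: [::]] ]%N.

(** For each group of [grps], the graph of the trivial character, followed where needed by that of
    delta; for the group of D the only graph is that of eps D. The omega-twists come from the dual
    graphs. *)
Definition base_wdata : seq (seq wdata) :=
  [:: [:: unitwd [:: [:: 2]; [:: 1]; [::]]
              [:: [:: 1]; [:: 0; 2]; [::]];
          unitwd [:: [:: 1; 2]; [:: 1]; [:: 2]]
              [:: [:: 1]; [:: 2]; [:: 1]]];
      [:: unitwd [:: [:: 2]; [:: 1]; [:: 0]; [:: 1]; [:: 2]; [::]]
              [:: [:: 1]; [:: 0; 2]; [:: 1; 3]; [:: 2; 4]; [:: 3; 5]; [::]];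
          unitwd [:: [:: 1; 2]; [:: 1]; [:: 0; 2]; [:: 1; 2]; [:: 2]; [:: 1]]
              [:: [:: 1]; [:: 2]; [:: 1; 3]; [:: 2; 4]; [:: 5]; [:: 4]]];
      [:: unitwd [:: [:: 1]; [:: 0; 2]; [:: 1; 2]; [:: 0]; [:: 2]; [:: 1];
                  [:: 1]; [:: 0; 2]; [:: 0]; [:: 2]; [:: 1]; [::]]
              [:: [:: 1]; [:: 0; 2; 3]; [:: 1; 4; 5]; [:: 5]; [:: 6];
                  [:: 3; 7]; [:: 4; 8]; [:: 4; 5; 8; 9]; [:: 6; 10]; [:: 10];
                  [:: 8; 9; 11]; [::]];
          unitwd [:: [:: 1; 2]; [:: 0; 2]; [:: 1; 2]; [:: 0; 1]; [:: 2]; [:: 1];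
                  [:: 1]; [:: 0; 2]; [:: 0]; [:: 1; 2]; [:: 1]; [:: 2]]
              [:: [:: 1]; [:: 0; 2; 3]; [:: 1; 4; 5]; [:: 1; 5]; [:: 6];
                  [:: 7]; [:: 4; 8]; [:: 4; 5; 8; 9]; [:: 6; 10]; [:: 7; 10];
                  [:: 8; 11]; [:: 10]]];
      [:: unitwd [:: [:: 0]; [:: 1]; [:: 0; 2]; [::]]
              [:: [:: 1]; [:: 0; 2]; [:: 1; 3]; [::]]];
      [:: unitwd [:: [:: 0]; [:: 1]; [:: 0; 2]; [:: 2]; [:: 0]; [:: 1]; [:: 0];
                  [::]]
              [:: [:: 1]; [:: 0; 2]; [:: 1; 3; 4]; [:: 5]; [:: 5];
                  [:: 3; 4; 6]; [:: 5; 7]; [::]]];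
      [:: unitwd [:: [:: 0; 2]; [:: 2]; [:: 0; 1]; [:: 1]; [:: 0]; [:: 0];
                  [:: 1]; [:: 1]; [:: 0; 2]; [:: 2]; [:: 0]; [::]]
              [:: [:: 1; 2]; [:: 3]; [:: 0; 3; 4]; [:: 1; 5]; [:: 6];
                  [:: 3; 7]; [:: 4; 8]; [:: 5; 9]; [:: 1; 5; 6; 9; 10];
                  [:: 7; 11]; [:: 11]; [::]]];
      [:: unitwd [:: [:: 0; 1; 2]; [::]]
              [:: [:: 1]; [::]]];
      [:: unitwd [:: [::]]
              [:: [::]];
          unitwd [:: [:: 1; 2]]
              [:: [::]]] ]%N.

Definition reps_of (d : sterm) : seq word := nth [::] grp_reps d.1.

(* If M is the module of a W-graph and M' its twist by T_s |-> - T_s^-1, this is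
   the W-graph of the dual of M'; the natural lattices are self-dual, because
   they have an orthonormal basis permuted up to signs. *)
Definition dual_wdata n (D : wdata) : wdata :=
  WData [seq [seq s <- iota 0 3 | s \notin t] | t <- wd_tau D]
        [seq [seq x <- iota 0 n | y \in nth [::] (wd_adj D) x] | y <- iota 0 n]
        (- wd_c D).

Definition is_dual (d : sterm) : bool := if d.1 == 5 then d.2.2 else d.2.1.

Definition base_of (d : sterm) : wdata :=
  let l := nth [::] base_wdata d.1 in
  nth (unitwd [::] [::]) l (if size l == 1 then 0 else d.2.1 (+) d.2.2).

Definition wdata_of (d : sterm) : wdata :=
  let D := base_of d in
  if is_dual d then dual_wdata (size (reps_of d)) D else D.

(* At v = 1, the columns are the vectors r C_0 for r in the transversal R, where
   C_0, the minimal element of the W-graph basis, generates the lattice. *)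
Definition orbit_mx (R : seq word) (D : wdata) : pmat :=
  let n := size R in
  let S := [seq pmx1 n n (wd_mat D n s) | s <- iota 0 3] in
  let cols := [seq foldr (fun s c => pmulmx n n 1 (nth [::] S s) c)
                 (mkmat n 1 (fun i _ => [:: (i == 0)%:R])) w | w <- R] in
  mkmat n n (fun i j => ent (nth [::] cols j) i 0).

(** The geometric series 1 + N + ... + N^(n-1) for N = 1 - A. That it inverts A is verified in
    [special_check]. *)
Definition unipotent_inverse n (A : pmat) : pmat :=
  let N := paddmx n n (pscalar n [:: 1]) (mkmat n n (fun i j => popp (ent A i j))) in
  iter n (fun X => paddmx n n (pscalar n [:: 1]) (pmulmx n n n N X)) [::].

(* Multiplying the basis vector r of the natural lattice by omega(r) turns the
   matrices of a term into those of its twist by omega. *)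
Definition sign_mx (R : seq word) : pmat :=
  mkmat (size R) (size R) (fun i j =>
    if i == j then [:: (-1) ^+ size (nth [::] R i)] else [::]).

(** Dualizing replaces the base change by its inverse transpose, and the omega-twist multiplies it
    by the sign matrix. *)
Definition wgraph_check_of (d : sterm) : bool :=
  let R := reps_of d in let n := size R in
  let G' := orbit_mx R (base_of d) in let G := unipotent_inverse n G' in
  if is_dual d then
    let S := sign_mx R in
    wgraph_check d R (wdata_of d)
      (pmulmx n n n S (ptrmx n n G')) (pmulmx n n n (ptrmx n n G) S)
  else wgraph_check d R (wdata_of d) G G'.

Definition good_terms : seq sterm :=
  [seq (k, b) | k <- [:: 0; 1; 2; 7]%N,
     b <- [:: (false, false); (false, true); (true, false); (true, true)]]
  ++ [seq (k, b) | k <- [:: 3; 4; 6]%N, b <- [:: (false, false); (true, true)]]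
  ++ [:: (5%N, (true, false)); (5%N, (false, true))].

Lemma good_terms_check : all wgraph_check_of good_terms.
Proof. by vm_compute. Qed.

Lemma good_wgraph t d : denotes t d -> d \in good_terms -> canonical_wgraph_lattice t.
Proof.
move=> td /(allP good_terms_check); rewrite /wgraph_check_of.
by case: ifP => _; apply: wgraph_checkP td.
Qed.

(** * The four exceptional terms *)

(* The terms F_delta, F_eps, L_- and omega L_-. *)
Definition bad_terms : seq sterm :=
  [seq (k, b) | k <- [:: 3; 6]%N, b <- [:: (false, true); (true, false)]].

Definition all_terms : seq sterm := good_terms ++ bad_terms.

Definition pconst (A : seq (seq int)) : pmat := [seq [seq [:: a] | a <- r] | r <- A].

(** In all four cases s0 s2 has trace -2, so a W-graph of rank 4 or 2 would force s0 - 1 to have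
    rank at most 1 or 0 modulo 2; the matrices U and V exhibit rank 2 or 1. *)
Definition obstruction_check_of (d : sterm) : bool :=
  if d.1 == 3 then
    obstruction_check d (reps_of d) 2 (pconst [:: [:: 0; 1; 0; 0]; [:: 0; 0; 0; 1]])
      (pconst [:: [:: 1; 0]; [:: 0; 0]; [:: 0; 1]; [:: 0; 0]])
  else
    obstruction_check d (reps_of d) 1 (pconst [:: [:: 0; 1]])
      (pconst [:: [:: 1]; [:: 0]]).

Lemma bad_terms_obstruction : all obstruction_check_of bad_terms.
Proof. by vm_compute. Qed.

Lemma bad_wgraph t d : denotes t d -> d \in bad_terms -> ~ wgraph_lattice t.
Proof.
move=> td /(allP bad_terms_obstruction); rewrite /obstruction_check_of.
by case: ifP => _; apply: obstruction_checkP td.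
Qed.

(* For a polynomial p in q = v + v^-1, the polynomial v^k p(q). *)
Definition qpoly k (p : seq int) : seq int :=
  foldr (fun i s => padd
      (pmul (pmon (k - i) (nth 0 p i)) (iter i (pmul [:: 1; 0; 1]) [:: 1])) s)
    [::] (iota 0 (size p)).

(* T_s = v - c_s for matrices c_s over Z[q], so that T_s is multiplied by
   v^(k+1) here. *)
Definition qmats k n (c : seq pmat) : seq pmat :=
  [seq mkmat n n (fun i j =>
     padd (if i == j then pmon k.+2 1 else [::]) (popp (qpoly k.+1 (ent B i j))))
  | B <- c].

(* In the basis e, e - s0 e, -f, s0 f - f, where f = s1 s0 e. *)
Definition c_Feps : seq pmat :=
  let q := [:: 0; 1] in
  (* The matrix of s1 is the product r l of a column and a row with l r = q, whence its square is q
     times itself. *)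
  let r := [:: [:: 3; 0; -1]; [:: -1; 1]; [:: -1]; [::]] in
  let l := [:: [::]; [:: 1]; [:: -1]; [:: 1; -1]] in
  [:: [:: [::]; [:: [:: 1]; q]; [::]; [:: [::]; [::]; [:: 1]; q]];
      [seq [seq pmul a b | b <- l] | a <- r];
      [:: [::]; [::]; [:: [::]; [::]; q]; [:: [::]; [::]; [:: -1]]] ].

(** In the basis e, s0 e - e. The matrices of s1 and s2 are q minus that of s0, that is T_s1 = T_s2
    = - T_s0^-1: everything commutes, and only the quadratic relation has content. *)
Definition c_Lm : seq pmat :=
  let q := [:: 0; 1] in
  [:: [:: [::]; [:: [:: -1]; q]];
      [:: [:: q]; [:: [:: 1]]];
      [:: [:: q]; [:: [:: 1]]] ].

(* The twist by omega is T_s |-> - T_s^-1, that is c_s |-> q - c_s. *)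
Definition c_omega n (c : seq pmat) : seq pmat :=
  [seq paddmx n n (pscalar n [:: 0; 1])
         (mkmat n n (fun i j => popp (ent B i j))) | B <- c].

(** The parameter 2 allows degree 3 in q, attained by the entry (3 - q^2)(1 - q) for F_eps. F_delta
    and omega L_- are treated as omega-twists of F_eps and L_-. *)
Definition deformation_check_of (d : sterm) : bool :=
  let R := reps_of d in let n := size R in
  let check tw c G G' :=
    if tw then
      let S := sign_mx R in
      deformation_check d 2 R (qmats 2 n (c_omega n c))
        (pmulmx n n n S G) (pmulmx n n n G' S)
    else deformation_check d 2 R (qmats 2 n c) G G' in
  if d.1 == 3 then
    let G := pconst [:: [:: 1; 1; 0; 0]; [:: 0; -1; 0; 0];
                        [:: 0; 0; -1; -1]; [:: 0; 0; 0; 1]] in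
    check d.2.2 c_Feps G G
  else
    check d.2.1 c_Lm (pconst [:: [:: 1; -1]; [:: 0; 1]])
      (pconst [:: [:: 1; 1]; [:: 0; 1]]).

Lemma bad_terms_deformation : all deformation_check_of bad_terms.
Proof. by vm_compute. Qed.

Lemma bad_deformation t d : denotes t d -> d \in bad_terms -> canonical_deformation t.
Proof.
move=> td /(allP bad_terms_deformation); rewrite /deformation_check_of.
by case: ifP => _; case: ifP => _; apply: deformation_checkP td.
Qed.

(** * The twenty-four models as lists of terms *)

(* [true] for the perfect models. *)
Definition smodel_base (p : bool) (i : nat) : seq sterm :=
  let t := (false, false) in let d := (false, true) in
  let e := (true, false) in let w := (true, true) in
  nth [::]
    (if p then
      [:: [:: (4, t); (5, d)];
          [:: (4, t); (1, d); (1, w)];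
          [:: (1, e); (2, d); (7, t); (7, w)];
          [:: (2, w); (1, t); (7, d); (7, e)] ]
    else
      [:: [:: (3, t); (3, e); (1, d); (1, w)];
          [:: (3, t); (3, e); (5, d)];
          [:: (3, t); (2, d); (0, e); (7, w)];
          [:: (3, t); (2, d); (0, w); (7, e)];
          [:: (1, e); (2, d); (6, t)];
          [:: (2, w); (3, e); (0, t); (7, d)];
          [:: (2, w); (3, e); (0, d); (7, t)];
          [:: (2, w); (1, t); (6, d)] ])%N i.

Definition model_key (k : model_index) : bool * nat * bool :=
  match k with inl (i, b) => (true, i : nat, b) | inr (i, b) => (false, i : nat, b) end.

Definition smodel_at (x : bool * nat * bool) : seq sterm :=
  let M := smodel_base x.1.1 x.1.2 in if x.2 then map stwist M else M.

Definition smodel (k : model_index) : seq sterm := smodel_at (model_key k).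

Lemma linsgn_twist_delta : linsgn (linmul delta chi_triv) (false, true).
Proof. exact: linsgn_mul linsgn_delta linsgn_triv. Qed.

Ltac solve_denotes :=
  repeat apply: List.Forall2_cons; try exact: List.Forall2_nil;
  (apply: denotes_Term => //;
   first [exact: linsgn_triv | exact: linsgn_delta | exact: linsgn_eps
     | exact: linsgn_omega | exact: linsgn_twist_delta]).

Lemma smodel_denotes k : List.Forall2 denotes (the_model k) (smodel k).
Proof.
have base : List.Forall2 denotes (the_model (match k with
    inl (i, _) => inl (i, false) | inr (i, _) => inr (i, false) end))
  (smodel_base (model_key k).1.1 (model_key k).1.2).
  case: k => [[[i i_lt] b]|[[i i_lt] b]] /=.
    case: i i_lt => [|[|[|[|]]]] //= i_lt; solve_denotes.
  case: i i_lt => [|[|[|[|[|[|[|[|]]]]]]]] //= i_lt; solve_denotes.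
have twist M ds : List.Forall2 denotes M ds ->
    List.Forall2 denotes (map (term_twist omega) M) (map stwist ds).
  by elim=> [|t d M' ds' td _ IH]; constructor; rewrite //; apply: denotes_omega.
by case: k base => [[i []]|[i []]] //=; apply: twist.
Qed.

Lemma smodel_in k t : in_model t (the_model k) ->
  exists2 d, d \in smodel k & denotes t d.
Proof.
rewrite /in_model.
elim: (smodel_denotes k) => [|t' d M ds td _ IH] //= [<-|/IH[d' dd' td']].
  by exists d; rewrite ?mem_head.
by exists d'; rewrite // inE dd' orbT.
Qed.

Lemma smodel_ex k d : d \in smodel k ->
  exists2 t, in_model t (the_model k) & denotes t d.
Proof.
rewrite /in_model; elim: (smodel_denotes k) => [|t d' M ds td _ IH] //=.
rewrite inE => /orP[/eqP->|/IH[t' tM td']]; first by exists t; [left|].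
by exists t'; [right|].
Qed.

Definition model_keys : seq (bool * nat * bool) :=
  [seq (x, b) | x <- [seq (true, i) | i <- iota 0 4] ++ [seq (false, i) | i <- iota 0 8],
                b <- [:: false; true]].

Lemma model_key_in k : model_key k \in model_keys.
Proof.
case: k => [[i b]|[i b]]; apply: allpairs_f; try by case: b.
  by rewrite mem_cat map_f // mem_iota /=.
by rewrite mem_cat orbC map_f // mem_iota /=.
Qed.

Lemma model_key_inj : injective model_key.
Proof.
by case=> [[i b]|[i b]] [[j c]|[j c]] //= [/val_inj-> ->].
Qed.

Lemma smodel_terms k d : d \in smodel k -> d \in all_terms.
Proof.
have : all (fun x => all (fun d => d \in all_terms) (smodel_at x)) model_keys.
  by vm_compute.
by move=> /allP/(_ _ (model_key_in k))/allP; apply.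
Qed.

Definition wg_model (k : model_index) : bool := all (fun d => d \in good_terms) (smodel k).

Lemma not_wg_model k : ~~ wg_model k ->
  exists2 t, in_model t (the_model k) & ~ wgraph_lattice t.
Proof.
move=> /allPn[d dk dN]; have := smodel_terms dk; rewrite mem_cat (negPf dN) /= => dB.
by have [t tk td] := smodel_ex dk; exists t; last exact: bad_wgraph dB.
Qed.

Lemma termwiseP k : termwise_canonical_wgraphs (the_model k) <-> wg_model k.
Proof.
split=> [kW|/allP kG t /smodel_in[d /kG dG td]]; last exact: good_wgraph dG.
apply/negPn/negP => /not_wg_model[t /kW [n [G [T [GT _ Tt]]]]]; apply.
by exists n, G, T.
Qed.

Lemma wg_model_key k :
  wg_model k = (model_key k).1.1 || ((model_key k).1.2 \in [:: 2; 3; 4])%N.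
Proof.
have : all (fun x => all (fun d => d \in good_terms) (smodel_at x)
                     == x.1.1 || (x.1.2 \in [:: 2; 3; 4])%N) model_keys by vm_compute.
by move=> /allP/(_ _ (model_key_in k))/eqP.
Qed.

Definition separated (I T : eqType) (l : seq (I * seq T)) : bool :=
  all (fun x => all (fun y =>
    all (fun z => z \in y.2) x.2 && all (fun z => z \in x.2) y.2 ==> (x.1 == y.1)) l) l.

(* The vectors of all the terms are shared, for the sake of the computation. *)
Definition keyed_chars (C : seq (seq int)) : seq (bool * nat * bool * seq (seq int)) :=
  [seq (x, [seq nth [::] C (index d all_terms) | d <- smodel_at x]) | x <- model_keys].

Lemma models_distinct (j k : model_index) :
  model_chars (the_model j) =i model_chars (the_model k) -> j = k.
Proof.
move=> jk; apply: model_key_inj.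
have jk1 : {subset map charvec (smodel j) <= map charvec (smodel k)}.
  by apply: charvec_sub (smodel_denotes j) (smodel_denotes k) _ => c; rewrite jk.
have kj1 : {subset map charvec (smodel k) <= map charvec (smodel j)}.
  by apply: charvec_sub (smodel_denotes k) (smodel_denotes j) _ => c; rewrite jk.
have : separated (keyed_chars (map charvec all_terms)) by vm_compute.
have in_l i : (model_key i, map charvec (smodel i))
    \in keyed_chars (map charvec all_terms).
  have -> : map charvec (smodel i)
      = [seq nth [::] (map charvec all_terms) (index d all_terms) | d <- smodel i].
    apply/eq_in_map => d /smodel_terms dT.
    by rewrite (nth_map d) ?index_mem // nth_index.
  by apply/mapP; exists (model_key i); first exact: model_key_in.
move=> /allP/(_ _ (in_l j))/allP/(_ _ (in_l k))/implyP/= jkE; apply/eqP/jkE.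
by apply/andP; split; apply/allP.
Qed.

Theorem theorem7p7 :
  [/\ (* distinct indices give distinct models (as sets of characters) *)
      forall j k : model_index,
        model_chars (the_model j) =i model_chars (the_model k) -> j = k,
      forall (k : model_index) (t : term),
        in_model t (the_model k) -> canonical_deformation t,
      forall (i : 'I_8) (b : bool),
        termwise_canonical_wgraphs (the_model (inr (i, b)))
        <-> (i : nat) \in [:: 2; 3; 4]%N,
      forall (i : 'I_8) (b : bool),
        (i : nat) \notin [:: 2; 3; 4]%N ->
        exists2 t : term, in_model t (the_model (inr (i, b)))
                          & ~ wgraph_lattice t
    & (forall (i : 'I_4) (b : bool),
        termwise_canonical_wgraphs (the_model (inl (i, b))))
      /\ #|[set k : model_index
             | `[< termwise_canonical_wgraphs (the_model k) >]]| = 14%N].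
Proof.
split=> [||i b|i b iN|]; first exact: models_distinct.
- move=> k t /smodel_in[d /smodel_terms]; rewrite mem_cat => /orP[dG|dB] td.
    exact: canonical_wgraph_deformation (good_wgraph td dG).
  exact: bad_deformation dB.
- by rewrite termwiseP wg_model_key.
- by apply: not_wg_model; rewrite wg_model_key.
split=> [i b|]; first by apply/termwiseP; rewrite wg_model_key.
have -> : [set k : model_index | `[< termwise_canonical_wgraphs (the_model k) >]]
    = [set k | wg_model k].
  by apply/setP=> k; rewrite !inE; apply/asboolP/idP => /termwiseP.
(* The count splits into all 4 * 2 perfect models and 3 * 2 additional ones. *)
rewrite -sum1_card big_mkcond /= big_sumType /=.
rewrite (eq_bigr (fun=> 1%N)) => [|[i b] _]; last by rewrite inE wg_model_key.
rewrite sum1_card card_prod card_ord card_bool.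
pose F (i : 'I_8) (b : bool) := ((i : nat) \in [:: 2; 3; 4]%N : nat).
rewrite (eq_bigr (fun p => F p.1 p.2)) => [|[i b] _].
  by rewrite -pair_bigA /= !big_ord_recl big_ord0 !big_bool.
by rewrite inE wg_model_key /F /=; case: (_ \in _).
Qed.
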